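(* Let $R$ be a commutative artin ring, $\mathcal{C}$ a dualizing $R$-variety and $P=\mathrm{Hom}_{\mathcal{C}}(C,-)\in\mathrm{mod}(\mathcal{C})$. The following hold. (a) $\mathbb{I}_{1}=\mathbb{I}_{\infty}$ if and only if $P^{\ast}(C')=\mathrm{Hom}_{\mathrm{mod}(\mathcal{C})}(P,\mathrm{Hom}_{\mathcal{C}}(C',-))$ is a projective $R_{P}$-module for all $C'\in\mathcal{C}$. (b) $\mathbb{P}_{1}=\mathbb{P}_{\infty}$ if and only if $P(C')\simeq\mathrm{Hom}_{\mathrm{mod}(\mathcal{C})}(\mathrm{Hom}_{\mathcal{C}}(C',-),P)$ is a projective $R_{P}^{op}$-module for all $C'\in\mathcal{C}$.
   Context: A Hom-finite $R$-variety is a small additive category in which idempotents split, whose Hom-sets are finitely generated $R$-modules with $R$-bilinear composition. $\mathrm{Mod}(\mathcal{C})$ is the category of additive functors $\mathcal{C}\to\mathbf{Ab}$ and $\mathrm{mod}(\mathcal{C})$ its full subcategory of finitely presented functors. With $E$ the injective envelope of $R/\mathrm{rad}(R)$, put $\mathbb{D}_{\mathcal{C}}(M)(X)=\mathrm{Hom}_R(M(X),E)$ for functors with finitely generated values; $\mathcal{C}$ is dualizing if $\mathbb{D}_{\mathcal{C}}$ induces a duality between $\mathrm{mod}(\mathcal{C})$ and $\mathrm{mod}(\mathcal{C}^{op})$. $R_P=\mathrm{End}_{\mathrm{mod}(\mathcal{C})}(P)^{op}$; modules are left modules. $J=I_0(P/\mathrm{rad}(P))$ is the injective envelope of $P/\mathrm{rad}(P)$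 in $\mathrm{mod}(\mathcal{C})$, where $\mathrm{rad}(P)$ is the intersection of the maximal submodules. $\mathrm{add}(M)$ is the class of direct summands of finite direct sums of copies of $M$. For $0\leq k\leq\infty$, $\mathbb{P}_k$ (resp. $\mathbb{I}_k$) is the full subcategory of $\mathrm{mod}(\mathcal{C})$ of those $X$ having a projective resolution $\cdots\to P_1\to P_0\to X\to0$ with $P_i\in\mathrm{add}(P)$ for $0\leq i\leq k$ (resp. an injective coresolution $0\to X\to J_0\to J_1\to\cdots$ with $J_i\in\mathrm{add}(J)$ for $0\leq i\leq k$); for $k=\infty$ the condition is for all $i\geq0$. *)

(* Defs.v *)
From HB Require Import structures.
From mathcomp Require Import all_boot all_order all_algebra.
From mathcomp Require Import boolp classical_sets.

Set Implicit Arguments.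
Unset Strict Implicit.
Unset Printing Implicit Defensive.

Import GRing.Theory.
Local Open Scope classical_set_scope.
Local Open Scope ring_scope.

Section Ideals.
Variable R : comPzRingType.

Definition ideal (I : set R) : Prop :=
  [/\ I 0, forall x y, I x -> I y -> I (x + y) & forall a x, I x -> I (a * x)].

Definition artinian : Prop :=
  forall I : nat -> set R, (forall n, ideal (I n)) ->
    (forall n, I n.+1 `<=` I n) ->
    exists N, forall n, (N <= n)%N -> I n = I N.

Definition maximal_ideal (I : set R) : Prop :=
  [/\ ideal I, I != setT &
      forall K, ideal K -> I `<=` K -> K = I \/ K = setT].

Definition jacobson : set R := [set x | forall I, maximal_ideal I -> I x].

End Ideals.

Section Modules.
Variable A : pzRingType.

Definition projective_module (Q : lmodType A) : Prop :=
  forall (U V : lmodType A) (g : {linear U -> V}) (f : {linear Q -> V}),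
    (forall v, exists u, g u = v) ->
    exists h : {linear Q -> U}, forall x, g (h x) = f x.

Definition injective_module (Q : lmodType A) : Prop :=
  forall (U V : lmodType A) (g : {linear U -> V}) (f : {linear U -> Q}),
    injective g -> exists h : {linear V -> Q}, forall x, h (g x) = f x.

Definition injective_envelope_module (T Q : lmodType A)
    (i : {linear T -> Q}) : Prop :=
  [/\ injective_module Q, injective i &
      forall (V : lmodType A) (g : {linear Q -> V}),
        injective (g \o i) -> injective g].

Definition finitely_generated (U : lmodType A) : Prop :=
  exists n (v : 'I_n -> U),
    forall u, exists a : 'I_n -> A, u = \sum_(i < n) a i *: v i.

End Modules.

(* [E] is an injective envelope of [R / rad R]; the quotient is given by any
   surjection [R -> T] with kernel [rad R]. *)
Definition injective_envelope_top (R : comPzRingType) (E : lmodType R) : Prop :=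
  exists (T : lmodType R) (p : {linear R^o -> T}) (i : {linear T -> E}),
    [/\ forall t, exists x, p x = t,
        forall x, p x = 0 <-> jacobson x &
        injective_envelope_module i].

Record linCat (R : comPzRingType) := LinCat {
  obj :> Type;
  hom : obj -> obj -> lmodType R;
  idm : forall X, hom X X;
  comp : forall X Y Z, hom Y Z -> hom X Y -> hom X Z;
  compA : forall X Y Z W (h : hom Z W) (g : hom Y Z) (f : hom X Y),
    comp h (comp g f) = comp (comp h g) f;
  comp1m : forall X Y (f : hom X Y), comp (idm Y) f = f;
  compm1 : forall X Y (f : hom X Y), comp f (idm X) = f;
  comp_linearl : forall X Y Z (f : hom X Y),
    linear (fun g : hom Y Z => comp g f);
  comp_linearr : forall X Y Z (g : hom Y Z),
    linear (fun f : hom X Y => comp g f)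
}.

Arguments idm {R l} X.

Definition opcat (R : comPzRingType) (C : linCat R) : linCat R :=
  @LinCat R C (fun X Y => hom Y X) (fun X => idm X)
    (fun X Y Z g f => comp f g)
    (fun X Y Z W h g f => esym (compA f g h))
    (fun X Y f => compm1 f) (fun X Y f => comp1m f)
    (fun X Y Z f => @comp_linearr R C Z Y X f)
    (fun X Y Z g => @comp_linearl R C Z Y X g).

Lemma compZl (R : comPzRingType) (C : linCat R) (X Y Z : C) (f : hom X Y)
  (a : R) (g : hom Y Z) : comp (a *: g) f = a *: comp g f.
Proof.
have comp0 : comp (0 : hom Y Z) f = 0.
  have := comp_linearl f (-1) g g.
  by rewrite !scaleN1r !addNr.
by have := comp_linearl f a g 0; rewrite comp0 !addr0.
Qed.

Lemma compZr (R : comPzRingType) (C : linCat R) (X Y Z : C) (g : hom Y Z)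
  (a : R) (f : hom X Y) : comp g (a *: f) = a *: comp g f.
Proof. exact: (@compZl R (opcat C) Z Y X g a f). Qed.

Section Varieties.
Variables (R : comPzRingType) (C : linCat R).

Definition additive_category : Prop :=
  (exists Z : C, (forall X (f : hom X Z), f = 0) /\
                 (forall X (f : hom Z X), f = 0)) /\
  (forall X Y : C, exists (S : C) (i1 : hom X S) (i2 : hom Y S)
      (p1 : hom S X) (p2 : hom S Y),
     [/\ comp p1 i1 = idm X, comp p2 i2 = idm Y,
         comp p1 i2 = 0, comp p2 i1 = 0 &
         comp i1 p1 + comp i2 p2 = idm S]).

Definition idempotents_split : Prop :=
  forall (X : C) (e : hom X X), comp e e = e ->
    exists (Y : C) (r : hom X Y) (s : hom Y X),
      comp s r = e /\ comp r s = idm Y.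

Definition hom_finite_variety : Prop :=
  [/\ additive_category, idempotents_split &
      forall X Y : C, finitely_generated (hom X Y)].

End Varieties.

Record Mod (R : comPzRingType) (C : linCat R) := MkMod {
  fobj :> C -> zmodType;
  fmap : forall X Y, hom X Y -> {additive fobj X -> fobj Y};
  fmap1 : forall X (x : fobj X), fmap (idm X) x = x;
  fmapM : forall X Y Z (g : hom Y Z) (f : hom X Y) (x : fobj X),
    fmap (comp g f) x = fmap g (fmap f x);
  fmapD : forall X Y (f g : hom X Y) (x : fobj X),
    fmap (f + g) x = fmap f x + fmap g x
}.

Record Nat (R : comPzRingType) (C : linCat R) (M N : Mod C) := MkNat {
  app :> forall X, {additive M X -> N X};
  natural : forall X Y (f : hom X Y) (x : M X),
    app Y (fmap M f x) = fmap N f (app X x)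
}.

Lemma additive_ext (U V : zmodType) (f g : {additive U -> V}) :
  f =1 g -> f = g.
Proof.
case: f g => f [[cf]] [g [[cg]]] /= /funext fg.
by case: _ / fg in cg *; rewrite (Prop_irrelevance cf cg).
Qed.

Lemma linear_ext (A : pzRingType) (U V : lmodType A) (f g : {linear U -> V}) :
  f =1 g -> f = g.
Proof.
case: f g => f [[cf] [df]] [g [[cg] [dg]]] /= /funext fg.
by case: _ / fg in cg dg *;
  rewrite (Prop_irrelevance cf cg) (Prop_irrelevance df dg).
Qed.

Section NatZmod.
Variables (R : comPzRingType) (C : linCat R).

Lemma Nat_ext (M N : Mod C) (f g : Nat M N) :
  (forall X x, f X x = g X x) -> f = g.
Proof.
case: f g => f nf [g ng] /= fg.
have e : f = g.
  by apply: functional_extensionality_dep => X; apply: additive_ext; apply: fg.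
by move: nf ng; rewrite e => nf ng; rewrite (Prop_irrelevance nf ng).
Qed.

Definition nat_id (M : Mod C) : Nat M M :=
  @MkNat R C M M (fun X => idfun) (fun X Y f x => erefl).

Fact nat_comp_natural (L M N : Mod C) (g : Nat M N) (f : Nat L M)
    X Y (h : hom X Y) (x : L X) :
  (g Y \o f Y) (fmap L h x) = fmap N h ((g X \o f X) x).
Proof. by rewrite /= !natural. Qed.

Definition nat_comp (L M N : Mod C) (g : Nat M N) (f : Nat L M) : Nat L N :=
  MkNat (app := fun X => g X \o f X) (nat_comp_natural g f).

Section AbelianGroup.
Variables M N : Mod C.

Fact nat_zero_natural X Y (h : hom X Y) (x : M X) :
  (\0 : {additive M Y -> N Y}) (fmap M h x)
  = fmap N h ((\0 : {additive M X -> N X}) x).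
Proof. by rewrite /= raddf0. Qed.

Definition nat_zero : Nat M N :=
  MkNat (app := fun X => \0) nat_zero_natural.

Fact nat_opp_natural (f : Nat M N) X Y (h : hom X Y) (x : M X) :
  (\- f Y) (fmap M h x) = fmap N h ((\- f X) x).
Proof. by rewrite /= natural raddfN. Qed.

Definition nat_opp (f : Nat M N) : Nat M N :=
  MkNat (app := fun X => \- f X) (nat_opp_natural f).

Fact nat_add_natural (f g : Nat M N) X Y (h : hom X Y) (x : M X) :
  (f Y \+ g Y) (fmap M h x) = fmap N h ((f X \+ g X) x).
Proof. by rewrite /= !natural raddfD. Qed.

Definition nat_add (f g : Nat M N) : Nat M N :=
  MkNat (app := fun X => f X \+ g X) (nat_add_natural f g).

Fact nat_addA : associative nat_add.
Proof. by move=> f g h; apply: Nat_ext => X x /=; rewrite addrA. Qed.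
Fact nat_addC : commutative nat_add.
Proof. by move=> f g; apply: Nat_ext => X x /=; rewrite addrC. Qed.
Fact nat_add0 : left_id nat_zero nat_add.
Proof. by move=> f; apply: Nat_ext => X x /=; rewrite add0r. Qed.
Fact nat_addN : left_inverse nat_zero nat_opp nat_add.
Proof. by move=> f; apply: Nat_ext => X x /=; rewrite addNr. Qed.

HB.instance Definition _ := gen_eqMixin (Nat M N).
HB.instance Definition _ := gen_choiceMixin (Nat M N).
HB.instance Definition _ :=
  GRing.isZmodule.Build (Nat M N) nat_addA nat_addC nat_add0 nat_addN.

End AbelianGroup.

Definition EndMod (M : Mod C) : Type := Nat M M.
HB.instance Definition _ M := GRing.Zmodule.on (EndMod M).

Fact end_mulA M : associative (fun f g : EndMod M => nat_comp f g : EndMod M).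
Proof. by move=> f g h; apply: Nat_ext. Qed.
Fact end_mul1 M :
  left_id (nat_id M) (fun f g : EndMod M => nat_comp f g : EndMod M).
Proof. by move=> f; apply: Nat_ext. Qed.
Fact end_mulr1 M :
  right_id (nat_id M) (fun f g : EndMod M => nat_comp f g : EndMod M).
Proof. by move=> f; apply: Nat_ext. Qed.
Fact end_mulDl M :
  left_distributive (fun f g : EndMod M => nat_comp f g : EndMod M) +%R.
Proof. by move=> f g h; apply: Nat_ext. Qed.
Fact end_mulDr M :
  right_distributive (fun f g : EndMod M => nat_comp f g : EndMod M) +%R.
Proof. by move=> f g h; apply: Nat_ext => X x /=; rewrite raddfD. Qed.

HB.instance Definition _ M := GRing.Zmodule_isPzRing.Build (EndMod M)
  (@end_mulA M) (@end_mul1 M) (@end_mulr1 M) (@end_mulDl M) (@end_mulDr M).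

(* [End(P)^op]: the product [r * s] in [RP P] is [s] after [r]. *)
Definition RP (P : Mod C) : pzRingType := (EndMod P)^c.

(* [Hom(P, N)] as a left [RP P]-module, by precomposition. *)
Definition HomFrom (P N : Mod C) : Type := Nat P N.
HB.instance Definition _ P N := GRing.Zmodule.on (HomFrom P N).

Section HomFrom.
Variables P N : Mod C.
Definition homfrom_scale (r : RP P) (f : HomFrom P N) : HomFrom P N :=
  nat_comp f (r : Nat P P).
Fact homfrom_scaleA (a b : RP P) (v : HomFrom P N) :
  homfrom_scale a (homfrom_scale b v) = homfrom_scale (a * b) v.
Proof. by apply: Nat_ext. Qed.
Fact homfrom_scale1 : left_id 1 homfrom_scale.
Proof. by move=> v; apply: Nat_ext. Qed.
Fact homfrom_scaleDr : right_distributive homfrom_scale +%R.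
Proof. by move=> a u v; apply: Nat_ext. Qed.
Fact homfrom_scaleDl (v : HomFrom P N) :
  {morph homfrom_scale^~ v : a b / a + b >-> a + b}.
Proof. by move=> a b; apply: Nat_ext => X x /=; rewrite raddfD. Qed.
HB.instance Definition _ := GRing.Zmodule_isLmodule.Build (RP P) (HomFrom P N)
  homfrom_scaleA homfrom_scale1 homfrom_scaleDr homfrom_scaleDl.
End HomFrom.

(* [Hom(N, P)] as a left module over the opposite of [RP P], by
   postcomposition. *)
Definition HomTo (N P : Mod C) : Type := Nat N P.
HB.instance Definition _ N P := GRing.Zmodule.on (HomTo N P).

Section HomTo.
Variables N P : Mod C.
Definition homto_scale (r : (RP P)^c) (f : HomTo N P) : HomTo N P :=
  nat_comp (r : Nat P P) f.
Fact homto_scaleA (a b : (RP P)^c) (v : HomTo N P) :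
  homto_scale a (homto_scale b v) = homto_scale (a * b) v.
Proof. by apply: Nat_ext. Qed.
Fact homto_scale1 : left_id 1 homto_scale.
Proof. by move=> v; apply: Nat_ext. Qed.
Fact homto_scaleDr : right_distributive homto_scale +%R.
Proof. by move=> a u v; apply: Nat_ext => X x /=; rewrite raddfD. Qed.
Fact homto_scaleDl (v : HomTo N P) :
  {morph homto_scale^~ v : a b / a + b >-> a + b}.
Proof. by move=> a b; apply: Nat_ext. Qed.
HB.instance Definition _ := GRing.Zmodule_isLmodule.Build ((RP P)^c) (HomTo N P)
  homto_scaleA homto_scale1 homto_scaleDr homto_scaleDl.
End HomTo.

(* [P(X)] as a left module over the opposite of [RP P], by evaluation. *)
Definition Value (P : Mod C) (X : C) : Type := P X.
HB.instance Definition _ P X := GRing.Zmodule.on (Value P X).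

Section Value.
Variables (P : Mod C) (X : C).
Definition value_scale (r : (RP P)^c) (x : Value P X) : Value P X :=
  (r : Nat P P) X x.
Fact value_scaleA (a b : (RP P)^c) (v : Value P X) :
  value_scale a (value_scale b v) = value_scale (a * b) v.
Proof. by []. Qed.
Fact value_scale1 : left_id 1 value_scale.
Proof. by []. Qed.
Fact value_scaleDr : right_distributive value_scale +%R.
Proof. by move=> a u v; rewrite /value_scale raddfD. Qed.
Fact value_scaleDl (v : Value P X) :
  {morph value_scale^~ v : a b / a + b >-> a + b}.
Proof. by []. Qed.
HB.instance Definition _ := GRing.Zmodule_isLmodule.Build ((RP P)^c) (Value P X)
  value_scaleA value_scale1 value_scaleDr value_scaleDl.
End Value.

End NatZmod.

Section FunctorCategory.
Variables (R : comPzRingType) (C : linCat R).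

(* Exactness in [Mod C] is computed pointwise. *)
Definition nat_surj (M N : Mod C) (f : Nat M N) : Prop :=
  forall X y, exists x, f X x = y.

Definition nat_inj (M N : Mod C) (f : Nat M N) : Prop :=
  forall X, injective (f X).

Definition nat_exact (L M N : Mod C) (f : Nat L M) (g : Nat M N) : Prop :=
  forall X (y : M X), g X y = 0 <-> exists x, f X x = y.

Definition nat_iso (M N : Mod C) : Prop :=
  exists (f : Nat M N) (g : Nat N M),
    nat_comp g f = nat_id M /\ nat_comp f g = nat_id N.

Section Representable.
Variable A : C.

Definition post (X Y : C) (f : hom X Y) (g : hom A X) : hom A Y := comp f g.

Fact post_is_zmod_morphism X Y (f : hom X Y) : zmod_morphism (post f).
Proof.
move=> g h; have := comp_linearr f (-1) h g.
by rewrite !scaleN1r ![- _ + _]addrC.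
Qed.
HB.instance Definition _ X Y (f : hom X Y) :=
  GRing.isZmodMorphism.Build (hom A X) (hom A Y) (post f)
    (post_is_zmod_morphism f).

Fact post1 X (x : hom A X) : post (idm X) x = x.
Proof. exact: comp1m. Qed.
Fact postM X Y Z (g : hom Y Z) (f : hom X Y) (x : hom A X) :
  post (comp g f) x = post g (post f x).
Proof. by rewrite /post compA. Qed.
Fact postD X Y (f g : hom X Y) (x : hom A X) :
  post (f + g) x = post f x + post g x.
Proof. by have := comp_linearl x 1 f g; rewrite !scale1r. Qed.

(* The representable functor [Hom(A, -)]. *)
Definition yo : Mod C :=
  @MkMod R C (fun X => hom A X) (fun X Y f => post f) post1 postM postD.
End Representable.

Section Power.
Variables (M : Mod C) (n : nat).

Definition pow_map (X Y : C) (f : hom X Y) (u : {ffun 'I_n -> M X}) :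
  {ffun 'I_n -> M Y} := [ffun i => fmap M f (u i)].

Fact pow_map_is_zmod_morphism X Y (f : hom X Y) : zmod_morphism (pow_map f).
Proof. by move=> u v; apply/ffunP => i; rewrite !ffunE raddfB. Qed.
HB.instance Definition _ X Y (f : hom X Y) :=
  GRing.isZmodMorphism.Build {ffun 'I_n -> M X} {ffun 'I_n -> M Y} (pow_map f)
    (pow_map_is_zmod_morphism f).

Fact pow_map1 X (x : {ffun 'I_n -> M X}) : pow_map (idm X) x = x.
Proof. by apply/ffunP => i; rewrite ffunE fmap1. Qed.
Fact pow_mapM X Y Z (g : hom Y Z) (f : hom X Y) (x : {ffun 'I_n -> M X}) :
  pow_map (comp g f) x = pow_map g (pow_map f x).
Proof. by apply/ffunP => i; rewrite !ffunE fmapM. Qed.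
Fact pow_mapD X Y (f g : hom X Y) (x : {ffun 'I_n -> M X}) :
  pow_map (f + g) x = pow_map f x + pow_map g x.
Proof. by apply/ffunP => i; rewrite !ffunE fmapD. Qed.

Definition power : Mod C :=
  @MkMod R C (fun X => {ffun 'I_n -> M X}) (fun X Y f => pow_map f)
    pow_map1 pow_mapM pow_mapD.
End Power.

Section DirectSum.
Variables M N : Mod C.

Definition dsum_map (X Y : C) (f : hom X Y) (u : (M X * N X)%type) :
  (M Y * N Y)%type := (fmap M f u.1, fmap N f u.2).

Fact dsum_map_is_zmod_morphism X Y (f : hom X Y) : zmod_morphism (dsum_map f).
Proof. by move=> u v; rewrite /dsum_map !raddfB. Qed.
HB.instance Definition _ X Y (f : hom X Y) :=
  GRing.isZmodMorphism.Build (M X * N X)%type (M Y * N Y)%type (dsum_map f)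
    (dsum_map_is_zmod_morphism f).

Fact dsum_map1 X (x : (M X * N X)%type) : dsum_map (idm X) x = x.
Proof. by rewrite /dsum_map !fmap1; case: x. Qed.
Fact dsum_mapM X Y Z (g : hom Y Z) (f : hom X Y) (x : (M X * N X)%type) :
  dsum_map (comp g f) x = dsum_map g (dsum_map f x).
Proof. by rewrite /dsum_map !fmapM. Qed.
Fact dsum_mapD X Y (f g : hom X Y) (x : (M X * N X)%type) :
  dsum_map (f + g) x = dsum_map f x + dsum_map g x.
Proof. by rewrite /dsum_map !fmapD. Qed.

Definition dsum : Mod C :=
  @MkMod R C (fun X => (M X * N X)%type) (fun X Y f => dsum_map f)
    dsum_map1 dsum_mapM dsum_mapD.
End DirectSum.

Definition in_add (M X : Mod C) : Prop :=
  exists (Y : Mod C) (n : nat), nat_iso (dsum X Y) (power M n).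

Definition subfunctor (M : Mod C) (S : forall X, set (M X)) : Prop :=
  [/\ forall X, S X 0,
      forall X x y, S X x -> S X y -> S X (x - y) &
      forall X Y (f : hom X Y) x, S X x -> S Y (fmap M f x)].

Definition maximal_subfunctor (M : Mod C) (S : forall X, set (M X)) : Prop :=
  [/\ subfunctor S, exists X, S X != setT &
      forall S' : forall X, set (M X), subfunctor S' ->
        (forall X, S X `<=` S' X) ->
        (forall X, S' X = S X) \/ (forall X, S' X = setT)].

Definition radical (M : Mod C) (X : C) : set (M X) :=
  [set x | forall S : forall X, set (M X), maximal_subfunctor S -> S X x].

(* Since finite direct sums exist in an additive [C], a single representable
   covers finite sums of representables. *)
Definition finitely_presented (M : Mod C) : Prop :=
  exists (C1 C0 : C) (d : Nat (yo C1) (yo C0)) (e : Nat (yo C0) M),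
    nat_exact d e /\ nat_surj e.

Record fpMod := MkFpMod {
  fpmod :> Mod C;
  fpmodP : finitely_presented fpmod
}.

Definition projective (Q : fpMod) : Prop :=
  forall (M N : fpMod) (g : Nat M N) (f : Nat Q N), nat_surj g ->
    exists h : Nat Q M, nat_comp g h = f.

Definition injective_obj (Q : fpMod) : Prop :=
  forall (M N : fpMod) (g : Nat M N) (f : Nat M Q), nat_inj g ->
    exists h : Nat N Q, nat_comp h g = f.

Definition injective_envelope (T Q : fpMod) (i : Nat T Q) : Prop :=
  [/\ injective_obj Q, nat_inj i &
      forall (N : fpMod) (g : Nat Q N), nat_inj (nat_comp g i) -> nat_inj g].

(* [J] is an injective envelope in [mod C] of [P / rad P]; the quotient is
   given by any epimorphism [P -> T] with kernel [rad P]. *)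
Definition injective_envelope_top_of (P : Mod C) (J : fpMod) : Prop :=
  exists (T : fpMod) (p : Nat P T) (i : Nat T J),
    [/\ nat_surj p,
        forall X (x : P X), p X x = 0 <-> radical x &
        injective_envelope i].

(* Bounds [0 <= k <= oo] are elements of [option nat], [None] being [oo]. *)
Definition upto (k : option nat) (i : nat) : bool :=
  if k is Some n then (i <= n)%N else true.

Definition PP (P : Mod C) (k : option nat) (X : fpMod) : Prop :=
  exists (Q : nat -> fpMod) (e : Nat (Q 0%N) X)
             (d : forall i, Nat (Q i.+1) (Q i)),
     [/\ forall i, projective (Q i),
         nat_surj e,
         nat_exact (d 0%N) e,
         forall i, nat_exact (d i.+1) (d i) &
         forall i, upto k i -> in_add P (Q i)].

Definition II (J : Mod C) (k : option nat) (X : fpMod) : Prop :=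
  exists (Q : nat -> fpMod) (e : Nat X (Q 0%N))
             (d : forall i, Nat (Q i) (Q i.+1)),
     [/\ forall i, injective_obj (Q i),
         nat_inj e,
         nat_exact e (d 0%N),
         forall i, nat_exact (d i) (d i.+1) &
         forall i, upto k i -> in_add J (Q i)].

End FunctorCategory.

Section Dual.
Variables (R : comPzRingType) (C : linCat R).

(* The values of an additive functor are [R]-modules, a scalar [r] acting on
   [M X] as [M (r *: id)]. *)
Definition RValue (M : Mod C) (X : C) : Type := M X.
HB.instance Definition _ M X := GRing.Zmodule.on (RValue M X).

Section RValue.
Variables (M : Mod C) (X : C).
Definition rscale (r : R) (x : RValue M X) : RValue M X :=
  fmap M (r *: idm X) x.
Fact rscaleA (a b : R) (v : RValue M X) :
  rscale a (rscale b v) = rscale (a * b) v.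
Proof.
by rewrite /rscale -fmapM compZl comp1m scalerA.
Qed.
Fact rscale1 : left_id 1 rscale.
Proof. by move=> v; rewrite /rscale scale1r fmap1. Qed.
Fact rscaleDr : right_distributive rscale +%R.
Proof. by move=> a u v; rewrite /rscale raddfD. Qed.
Fact rscaleDl (v : RValue M X) : {morph rscale^~ v : a b / a + b >-> a + b}.
Proof. by move=> a b; rewrite /rscale scalerDl fmapD. Qed.
HB.instance Definition _ := GRing.Zmodule_isLmodule.Build R (RValue M X)
  rscaleA rscale1 rscaleDr rscaleDl.
End RValue.

Fact fmap_linear (M : Mod C) X Y (f : hom X Y) :
  linear (fmap M f : RValue M X -> RValue M Y).
Proof.
move=> a u v; rewrite raddfD; congr (_ + _).
rewrite /GRing.scale /= /rscale -!fmapM.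
by rewrite compZr compm1 compZl comp1m.
Qed.

Fact nat_linear (M N : Mod C) (f : Nat M N) X :
  linear (f X : RValue M X -> RValue N X).
Proof. by move=> a u v; rewrite raddfD; congr (_ + _); exact: natural. Qed.

Section LinZmod.
Variables U V : lmodType R.
Definition Lin : Type := {linear U -> V}.

Definition lin_zero : Lin := (\0 : {linear U -> V}).
Definition lin_opp (f : Lin) : Lin := (\- f : {linear U -> V}).
Definition lin_add (f g : Lin) : Lin := (f \+ g : {linear U -> V}).
Fact lin_addA : associative lin_add.
Proof. by move=> f g h; apply: linear_ext => x /=; rewrite addrA. Qed.
Fact lin_addC : commutative lin_add.
Proof. by move=> f g; apply: linear_ext => x /=; rewrite addrC. Qed.
Fact lin_add0 : left_id lin_zero lin_add.
Proof. by move=> f; apply: linear_ext => x /=; rewrite add0r. Qed.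
Fact lin_addN : left_inverse lin_zero lin_opp lin_add.
Proof. by move=> f; apply: linear_ext => x /=; rewrite addNr. Qed.
HB.instance Definition _ := gen_eqMixin Lin.
HB.instance Definition _ := gen_choiceMixin Lin.
HB.instance Definition _ :=
  GRing.isZmodule.Build Lin lin_addA lin_addC lin_add0 lin_addN.
End LinZmod.

Definition rmap (M : Mod C) X Y (f : hom X Y) (x : RValue M X) : RValue M Y :=
  fmap M f x.
HB.instance Definition _ (M : Mod C) X Y (f : hom X Y) :=
  GRing.isLinear.Build R (RValue M X) (RValue M Y) *:%R (rmap f)
    (fmap_linear f).

Definition rapp (M N : Mod C) (f : Nat M N) X (x : RValue M X) : RValue N X :=
  f X x.
HB.instance Definition _ (M N : Mod C) (f : Nat M N) X :=
  GRing.isLinear.Build R (RValue M X) (RValue N X) *:%R (@rapp M N f X)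
    (@nat_linear M N f X).

Variable E : lmodType R.

(* The functor [D M = Hom_R(M(-), E)] on the opposite category. *)
Section DualObject.
Variable M : Mod C.

Definition dual_map (X Y : C) (f : hom Y X) (u : Lin (RValue M X) E) :
  Lin (RValue M Y) E :=
  (u \o @rmap M Y X f : {linear RValue M Y -> E}).

Fact dual_map_is_zmod_morphism X Y (f : hom Y X) : zmod_morphism (dual_map f).
Proof. by move=> u v; apply: linear_ext. Qed.
HB.instance Definition _ X Y (f : hom Y X) :=
  GRing.isZmodMorphism.Build (Lin (RValue M X) E) (Lin (RValue M Y) E)
    (dual_map f) (dual_map_is_zmod_morphism f).

Fact dual_map1 X (u : Lin (RValue M X) E) : dual_map (idm X) u = u.
Proof. by apply: linear_ext => x /=; rewrite /rmap fmap1. Qed.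
Fact dual_mapM (X Y Z : C) (g : hom Z Y) (f : hom Y X)
    (u : Lin (RValue M X) E) :
  dual_map (comp f g) u = dual_map g (dual_map f u).
Proof. by apply: linear_ext => x /=; rewrite /rmap fmapM. Qed.
Fact dual_mapD (X Y : C) (f g : hom Y X) (u : Lin (RValue M X) E) :
  dual_map (f + g) u = dual_map f u + dual_map g u.
Proof. by apply: linear_ext => x /=; rewrite /rmap fmapD raddfD. Qed.

Definition dual : Mod (opcat C) :=
  @MkMod R (opcat C) (fun X => Lin (RValue M X) E) (fun X Y f => dual_map f)
    dual_map1 dual_mapM dual_mapD.
End DualObject.

Section DualMorphism.
Variables (M N : Mod C) (f : Nat M N).

Definition dual_app (X : C) (u : Lin (RValue N X) E) :
  Lin (RValue M X) E := (u \o @rapp M N f X : {linear RValue M X -> E}).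
Fact dual_app_is_zmod_morphism X : zmod_morphism (@dual_app X).
Proof. by move=> u v; apply: linear_ext. Qed.
HB.instance Definition _ X :=
  GRing.isZmodMorphism.Build (Lin (RValue N X) E) (Lin (RValue M X) E)
    (@dual_app X) (@dual_app_is_zmod_morphism X).

Fact dual_app_natural (X Y : opcat C) (h : hom X Y) (u : dual N X) :
  dual_app (fmap (dual N) h u) = fmap (dual M) h (dual_app u).
Proof. by apply: linear_ext => x /=; rewrite /rapp /rmap natural. Qed.

Definition dual_nat : Nat (dual N) (dual M) :=
  @MkNat R (opcat C) (dual N) (dual M) (fun X => @dual_app X) dual_app_natural.
End DualMorphism.

(* [D] restricts to a contravariant equivalence from [mod C] to
   [mod C^op]. *)
Definition dual_is_duality : Prop :=
  [/\ forall M : fpMod C, finitely_presented (dual M),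
      forall M N : fpMod C, bijective (@dual_nat M N) &
      forall N : fpMod (opcat C), exists M : fpMod C, nat_iso (dual M) N].

Definition dualizing_variety : Prop :=
  hom_finite_variety C /\ dual_is_duality.

End Dual.

(* Main.v *)
Require Import Defs.
From HB Require Import structures.
From mathcomp Require Import all_boot all_order all_algebra.
From mathcomp Require Import boolp classical_sets.

Set Implicit Arguments.
Unset Strict Implicit.
Unset Printing Implicit Defensive.

Import Defs GRing.Theory.
Local Open Scope ring_scope.

(** Write P for [yo A] and L for End(A), so that R_P is L and [hom A X] is
    the right L-module P(X).

    Part (b). A presentation of a functor by add(P) is a matrix over L up to
    direct summands, and it extends to a resolution by add(P) as soon as the
    kernels of such matrices in mod C are generated by their values at A
    ([flat_PP]). In terms of elements of the modules [hom A X] this generation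
    is the equational criterion of flatness over L, for every X
    ([flat_in_trace]). Conversely, if the cokernel of a matrix has a resolution
    by add(P), then comparing that resolution with the presentation given by the
    matrix, up to homotopy, shows that the kernel of the matrix is generated at
    A ([PP_flat]). Finally flat means projective here: [hom A X] is finitely
    presented over L because finitely presented functors on the opposite
    category have finitely generated kernels ([flat_dual_basis],
    [projective_Value]).

    Part (a) is part (b) for the opposite category. A duality D is used only
    through its formal properties: it exchanges projective and injective
    objects, preserves exactness and turns add(J) into add(D J) ([II_dual],
    [PP_dual]); it also provides kernels, as the duals of cokernels
    ([duality_fg_kernels]). What remains is to see that D J and hom(-, A) have
    the same additive closure. Let I be the functor with D I = hom(-, A), so
    that Hom(M, I) = Hom_R(M(A), E). On the one hand finitely many functionals
    separate the elements of T(A), where T = P / rad P; they embed T, hence its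
    essential extension J, in a finite power of I ([envelope_addc]). On the
    other hand every nonzero element of I has a multiple generating a simple
    L-module; L being finitely generated over the artinian ring R, that simple
    module embeds in L / rad L = T(A) ([simple_in_top]), and by injectivity of J
    the resulting map extends to I. So the maps from I to J are jointly
    injective, finitely many suffice by the descending chain condition, and I
    is a summand of a power of J ([addc_envelope]). *)

Notation "g \oC f" := (comp g f) (at level 40, left associativity).
Notation "g \oN f" := (nat_comp g f) (at level 40, left associativity).

(** * Bilinear composition and natural transformations *)

Section Bilinear.
Variables (R : comPzRingType) (C : linCat R).
Implicit Types X Y Z : C.

Lemma compDl X Y Z (f : hom X Y) (g h : hom Y Z) :
  (g + h) \oC f = g \oC f + h \oC f.
Proof. by have := comp_linearl f 1 g h; rewrite !scale1r. Qed.

Lemma compDr X Y Z (g : hom Y Z) (f h : hom X Y) :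
  g \oC (f + h) = g \oC f + g \oC h.
Proof. by have := comp_linearr g 1 f h; rewrite !scale1r. Qed.

Lemma comp0l X Y Z (f : hom X Y) : (0 : hom Y Z) \oC f = 0.
Proof. by rewrite -(scale0r (0 : hom Y Z)) compZl scale0r. Qed.

Lemma comp0r X Y Z (g : hom Y Z) : g \oC (0 : hom X Y) = 0.
Proof. by rewrite -(scale0r (0 : hom X Y)) compZr scale0r. Qed.

Lemma compNl X Y Z (f : hom X Y) (g : hom Y Z) : (- g) \oC f = - (g \oC f).
Proof. by rewrite -scaleN1r compZl scaleN1r. Qed.

Lemma compNr X Y Z (g : hom Y Z) (f : hom X Y) : g \oC (- f) = - (g \oC f).
Proof. by rewrite -scaleN1r compZr scaleN1r. Qed.

Lemma comp_suml X Y Z (f : hom X Y) I (r : seq I) (P : pred I)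
    (g : I -> hom Y Z) :
  (\sum_(i <- r | P i) g i) \oC f = \sum_(i <- r | P i) (g i \oC f).
Proof.
by elim/big_rec2: _ => [|i x y _ <-]; rewrite ?comp0l ?compDl.
Qed.

Lemma comp_sumr X Y Z (g : hom Y Z) I (r : seq I) (P : pred I)
    (f : I -> hom X Y) :
  g \oC (\sum_(i <- r | P i) f i) = \sum_(i <- r | P i) (g \oC f i).
Proof.
by elim/big_rec2: _ => [|i x y _ <-]; rewrite ?comp0r ?compDr.
Qed.

Lemma fmap0 (M : Mod C) X Y (x : M X) : fmap M (0 : hom X Y) x = 0.
Proof. by apply: (addrI (fmap M 0 x)); rewrite -fmapD !addr0. Qed.

Lemma fmapN (M : Mod C) X Y (f : hom X Y) (x : M X) :
  fmap M (- f) x = - fmap M f x.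
Proof. by apply: (addrI (fmap M f x)); rewrite -fmapD !subrr fmap0. Qed.

Lemma nat_sumE (M N : Mod C) I (r : seq I) (P : pred I) (f : I -> Nat M N) X x :
  (\sum_(i <- r | P i) f i) X x = \sum_(i <- r | P i) f i X x.
Proof. by elim/big_rec2: _ => [//|i y1 y2 _ <-]. Qed.

Lemma nat_congr (M N : Mod C) (f g : Nat M N) :
  f = g -> forall X (x : M X), f X x = g X x.
Proof. by move->. Qed.

Lemma nat_compA (K L M N : Mod C) (h : Nat M N) (g : Nat L M) (f : Nat K L) :
  h \oN (g \oN f) = h \oN g \oN f.
Proof. exact: Nat_ext. Qed.

Lemma nat_comp1l (M N : Mod C) (f : Nat M N) : nat_id N \oN f = f.
Proof. exact: Nat_ext. Qed.

Lemma nat_comp1r (M N : Mod C) (f : Nat M N) : f \oN nat_id M = f.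
Proof. exact: Nat_ext. Qed.

Lemma nat_comp0l (L M N : Mod C) (f : Nat L M) : (0 : Nat M N) \oN f = 0.
Proof. exact: Nat_ext. Qed.

Lemma nat_comp0r (L M N : Mod C) (f : Nat M N) : f \oN (0 : Nat L M) = 0.
Proof. by apply: Nat_ext => X x; rewrite /= raddf0. Qed.

Lemma nat_compBl (L M N : Mod C) (f : Nat L M) (g h : Nat M N) :
  (g - h) \oN f = g \oN f - h \oN f.
Proof. exact: Nat_ext. Qed.

Lemma nat_compBr (L M N : Mod C) (g : Nat M N) (f h : Nat L M) :
  g \oN (f - h) = g \oN f - g \oN h.
Proof. by apply: Nat_ext => X x; rewrite /= raddfB. Qed.

Lemma nat_comp_sumr (L M N : Mod C) (g : Nat M N) I (r : seq I) (P : pred I)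
    (f : I -> Nat L M) :
  g \oN (\sum_(i <- r | P i) f i) = \sum_(i <- r | P i) (g \oN f i).
Proof. by apply: Nat_ext => X x; rewrite /= !nat_sumE raddf_sum. Qed.

End Bilinear.


(** Attaches the additive structure to a function known to be additive only by
    a proof, as happens for functions obtained from a choice. *)
Definition additive_fun (U V : zmodType) (f : U -> V) of zmod_morphism f := f.
Arguments additive_fun {U V f} _ /.
HB.instance Definition _ (U V : zmodType) (f : U -> V) (fB : zmod_morphism f) :=
  GRing.isZmodMorphism.Build U V (additive_fun fB) fB.

Definition mk_nat (R : comPzRingType) (C : linCat R) (M N : Mod C)
    (f : forall X, M X -> N X) (fB : forall X, zmod_morphism (f X))
    (fN : forall X Y (h : hom X Y) x, f Y (fmap M h x) = fmap N h (f X x)) :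
  Nat M N := @MkNat R C M N (fun X => additive_fun (fB X)) fN.


(** * Representable functors and exact projectivity *)

Section Yoneda.
Variables (R : comPzRingType) (C : linCat R).
Implicit Types X Y Z : C.

Section Elements.
Variables (X : C) (M : Mod C) (x : M X).

Definition yoel_app Y (h : yo X Y) : M Y := fmap M (h : hom X Y) x.

Fact yoel_app_is_zmod_morphism Y : zmod_morphism (@yoel_app Y).
Proof. by move=> g h; rewrite /yoel_app fmapD fmapN. Qed.

Fact yoel_natural Y Z (f : hom Y Z) (h : yo X Y) :
  yoel_app (fmap (yo X) f h) = fmap M f (yoel_app h).
Proof. exact: fmapM. Qed.

Definition yoel : Nat (yo X) M :=
  mk_nat yoel_app_is_zmod_morphism yoel_natural.

End Elements.

Lemma yoel_id X (M : Mod C) (x : M X) : yoel x X (idm X) = x.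
Proof. exact: fmap1. Qed.

Lemma nat_yoE X (M : Mod C) (f : Nat (yo X) M) Y (h : yo X Y) :
  f Y h = fmap M (h : hom X Y) (f X (idm X)).
Proof. by rewrite -natural /= /post compm1. Qed.

Lemma yoneda_ext X (M : Mod C) (f g : Nat (yo X) M) :
  f X (idm X) = g X (idm X) -> f = g.
Proof. by move=> e; apply: Nat_ext => Y h; rewrite nat_yoE e -nat_yoE. Qed.

Lemma comp_yoel X (M N : Mod C) (f : Nat M N) (x : M X) :
  f \oN yoel x = yoel (f X x).
Proof. by apply: yoneda_ext; rewrite /= /yoel_app !fmap1. Qed.

Lemma nat_eq0P (M N : Mod C) (f : Nat M N) : (forall X x, f X x = 0) -> f = 0.
Proof. by move=> f0; apply: Nat_ext. Qed.

(** Projectivity with respect to all pointwise exact sequences of additive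
    functors. Unlike [projective] it does not require the functors tested to be
    finitely presented, and it applies to exactness in the middle of a
    resolution. *)
Definition exproj (Q : Mod C) : Prop :=
  forall (L M N : Mod C) (f : Nat L M) (g : Nat M N), nat_exact f g ->
  forall u : Nat Q M, g \oN u = 0 -> exists v : Nat Q L, f \oN v = u.

Lemma exproj_yo X : exproj (yo X).
Proof.
move=> L M N f g fg u gu0.
have /fg [y fy] : g X (u X (idm X)) = 0.
  exact: (nat_congr gu0).
by exists (yoel y); apply: yoneda_ext; rewrite /= /yoel_app fmap1.
Qed.

Lemma exproj_surj (Q M N : Mod C) (g : Nat M N) (u : Nat Q N) :
  exproj Q -> nat_surj g -> exists v : Nat Q M, g \oN v = u.
Proof.
move=> Qp g_surj; apply: (Qp M N N g 0) => [X y|]; last exact: nat_comp0l.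
by split=> // _; exact: g_surj.
Qed.

Lemma exproj_projective (Q : fpMod C) : exproj Q -> projective Q.
Proof. by move=> Qp M N g f g_surj; exact: exproj_surj. Qed.

End Yoneda.

(** * Additive closure *)

Section AddClosure.
Variables (R : comPzRingType) (C : linCat R).

(** Membership in add(M) without reference to a complement: an equation between
    finitely many morphisms, which every additive functor preserves. *)
Definition addc (M X : Mod C) : Prop :=
  exists n (a : 'I_n -> Nat X M) (b : 'I_n -> Nat M X),
    \sum_i (b i \oN a i) = nat_id X.

Lemma addcE (M X : Mod C) n (a : 'I_n -> Nat X M) (b : 'I_n -> Nat M X) :
  \sum_i (b i \oN a i) = nat_id X ->
  forall Y (x : X Y), x = \sum_i b i Y (a i Y x).
Proof.
by move=> e Y x; have := nat_congr e x; rewrite nat_sumE => ->.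
Qed.

Lemma addc_finite (I : finType) (M X : Mod C) (a : I -> Nat X M)
    (b : I -> Nat M X) :
  \sum_i (b i \oN a i) = nat_id X -> addc M X.
Proof.
move=> e; exists #|I|, (fun i => a (enum_val i)), (fun i => b (enum_val i)).
rewrite -e (reindex (@enum_val I I)) //=; apply/onW_bij/enum_val_bij.
Qed.

Lemma addc_trans (L M N : Mod C) : addc L M -> addc M N -> addc L N.
Proof.
move=> [m [a [b e]]] [n [a' [b' e']]].
apply: (@addc_finite ('I_n * 'I_m)%type _ _
  (fun ij => a ij.2 \oN a' ij.1) (fun ij => b' ij.1 \oN b ij.2)).
rewrite -(pair_bigA _ (fun i j => b' i \oN b j \oN (a j \oN a' i))) -e' /=.
apply: eq_bigr => i _; apply: Nat_ext => X x.
rewrite nat_sumE /= -raddf_sum; congr (b' i X _).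
by rewrite -(addcE e).
Qed.

Lemma retract_addc (M X : Mod C) (a : Nat X M) (b : Nat M X) :
  b \oN a = nat_id X -> addc M X.
Proof. by move=> e; exists 1%N, (fun=> a), (fun=> b); rewrite big_ord1. Qed.

Lemma exproj_addc (M X : Mod C) : addc M X -> exproj M -> exproj X.
Proof.
move=> [n [a [b e]]] Mp K L N f g fg u gu0.
have lift i : exists v : Nat M K, f \oN v = u \oN b i.
  by apply: Mp fg _ _; rewrite nat_compA gu0 nat_comp0l.
pose v i := sval (cid (lift i)).
exists (\sum_i (v i \oN a i)); rewrite nat_comp_sumr -[RHS]nat_comp1r -e.
rewrite nat_comp_sumr; apply: eq_bigr => i _.
by rewrite !nat_compA /v; case: (cid _) => /= w ->.
Qed.

Section Kernel.
Variables (M N : Mod C) (f : Nat M N).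

Definition ker_pred X : {pred M X} := fun x => f X x == 0.
Fact ker_zmod_closed X : zmod_closed (@ker_pred X).
Proof.
split=> [|x y]; rewrite !unfold_in /ker_pred ?raddf0 //.
by rewrite raddfB => /eqP -> /eqP ->; rewrite subr0.
Qed.
HB.instance Definition _ X :=
  GRing.isZmodClosed.Build (M X) (@ker_pred X) (@ker_zmod_closed X).
Definition ker_sub X : Type := {x : M X | ker_pred x}.
HB.instance Definition _ X := SubChoice.on (ker_sub X).
HB.instance Definition _ X := [SubChoice_isSubZmodule of ker_sub X by <:].

Fact ker_mapP X Y (h : hom X Y) (x : ker_sub X) :
  ker_pred (fmap M h (val x)).
Proof. by case: x => x /= /eqP fx; rewrite /ker_pred natural fx raddf0. Qed.
Definition ker_map X Y (h : hom X Y) (x : ker_sub X) : ker_sub Y :=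
  Sub _ (ker_mapP h x).
Fact ker_map_is_zmod_morphism X Y (h : hom X Y) : zmod_morphism (ker_map h).
Proof. by move=> x y; apply: val_inj; rewrite /= raddfB. Qed.
HB.instance Definition _ X Y (h : hom X Y) :=
  GRing.isZmodMorphism.Build (ker_sub X) (ker_sub Y) (ker_map h)
    (ker_map_is_zmod_morphism h).

Fact ker_map1 X (x : ker_sub X) : ker_map (idm X) x = x.
Proof. by apply: val_inj; rewrite /= fmap1. Qed.
Fact ker_mapM X Y Z (g : hom Y Z) (h : hom X Y) (x : ker_sub X) :
  ker_map (g \oC h) x = ker_map g (ker_map h x).
Proof. by apply: val_inj; rewrite /= fmapM. Qed.
Fact ker_mapD X Y (g h : hom X Y) (x : ker_sub X) :
  ker_map (g + h) x = ker_map g x + ker_map h x.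
Proof. by apply: val_inj; rewrite /= fmapD. Qed.
Definition ker : Mod C :=
  @MkMod R C (fun X => ker_sub X) (fun X Y h => ker_map h)
    ker_map1 ker_mapM ker_mapD.
End Kernel.

Section InAdd.
Variables M X : Mod C.

Section PowerMap.
Variables (n : nat) (a : 'I_n -> Nat X M) (b : 'I_n -> Nat M X).

Definition pow_in_app Y (x : X Y) : {ffun 'I_n -> M Y} := [ffun i => a i Y x].
Fact pow_in_is_zmod_morphism Y : zmod_morphism (@pow_in_app Y).
Proof. by move=> x y; apply/ffunP => i; rewrite !ffunE raddfB. Qed.
Fact pow_in_natural Y Z (h : hom Y Z) (x : X Y) :
  pow_in_app (fmap X h x) = fmap (power M n) h (pow_in_app x).
Proof. by apply/ffunP => i; rewrite !ffunE natural. Qed.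
Definition pow_in : Nat X (power M n) :=
  mk_nat (N := power M n) pow_in_is_zmod_morphism pow_in_natural.

Definition pow_out_app Y (v : {ffun 'I_n -> M Y}) : X Y := \sum_i b i Y (v i).
Fact pow_out_is_zmod_morphism Y : zmod_morphism (@pow_out_app Y).
Proof.
move=> u v; rewrite /pow_out_app -sumrB; apply: eq_bigr => i _.
by rewrite !ffunE raddfB.
Qed.
Fact pow_out_natural Y Z (h : hom Y Z) (v : power M n Y) :
  pow_out_app (fmap (power M n) h v) = fmap X h (pow_out_app v).
Proof.
by rewrite /pow_out_app raddf_sum; apply: eq_bigr => i _; rewrite ffunE natural.
Qed.
Definition pow_out : Nat (power M n) X :=
  mk_nat (M := power M n) pow_out_is_zmod_morphism pow_out_natural.
End PowerMap.
End InAdd.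

Section SumMap.
Variables L M N : Mod C.

Definition sum_out_app (f : Nat M L) (g : Nat N L) Y (u : M Y * N Y) : L Y :=
  f Y u.1 + g Y u.2.
Fact sum_out_is_zmod_morphism f g Y : zmod_morphism (@sum_out_app f g Y).
Proof. by move=> u v; rewrite /sum_out_app !raddfB addrACA -opprD. Qed.
Fact sum_out_natural f g Y Z (h : hom Y Z) (u : dsum M N Y) :
  sum_out_app f g (fmap (dsum M N) h u) = fmap L h (sum_out_app f g u).
Proof. by rewrite /sum_out_app /= !natural raddfD. Qed.
Definition sum_out f g : Nat (dsum M N) L :=
  mk_nat (M := dsum M N) (sum_out_is_zmod_morphism f g) (sum_out_natural f g).

Definition sum_in_app (f : Nat L M) (g : Nat L N) Y (x : L Y) : M Y * N Y :=
  (f Y x, g Y x).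
Fact sum_in_is_zmod_morphism f g Y : zmod_morphism (@sum_in_app f g Y).
Proof. by move=> u v; rewrite /sum_in_app !raddfB. Qed.
Fact sum_in_natural f g Y Z (h : hom Y Z) (x : L Y) :
  sum_in_app f g (fmap L h x) = fmap (dsum M N) h (sum_in_app f g x).
Proof. by rewrite /sum_in_app /= !natural. Qed.
Definition sum_in f g : Nat L (dsum M N) :=
  mk_nat (N := dsum M N) (sum_in_is_zmod_morphism f g) (sum_in_natural f g).
End SumMap.

End AddClosure.

Section InAddP.
Variables (R : comPzRingType) (C : linCat R).

Section KernelMaps.
Variables (M N : Mod C) (f : Nat M N).

Definition ker_inc_app X (x : ker_sub f X) : M X := val x.
Fact ker_inc_is_zmod_morphism X : zmod_morphism (@ker_inc_app X).
Proof. by []. Qed.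
Definition ker_inc : Nat (ker f) M :=
  mk_nat (M := ker f) ker_inc_is_zmod_morphism (fun X Y h x => erefl).

Variables (L : Mod C) (u : Nat L M) (fu0 : f \oN u = 0).
Fact ker_liftP X (x : L X) : ker_pred f (u X x).
Proof. by rewrite /ker_pred; have /= -> := nat_congr fu0 x. Qed.
Definition ker_lift_app X (x : L X) : ker_sub f X := Sub _ (ker_liftP x).
Fact ker_lift_is_zmod_morphism X : zmod_morphism (@ker_lift_app X).
Proof. by move=> x y; apply: val_inj; rewrite /= raddfB. Qed.
Fact ker_lift_natural X Y (h : hom X Y) (x : L X) :
  ker_lift_app (fmap L h x) = fmap (ker f) h (ker_lift_app x).
Proof. by apply: val_inj; rewrite /= natural. Qed.
Definition ker_lift : Nat L (ker f) :=
  mk_nat (N := ker f) ker_lift_is_zmod_morphism ker_lift_natural.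
End KernelMaps.

Lemma pow_out_in (M X : Mod C) n (a : 'I_n -> Nat X M) (b : 'I_n -> Nat M X) :
  pow_out b \oN pow_in a = \sum_i (b i \oN a i).
Proof.
apply: Nat_ext => Y x; rewrite nat_sumE /= /pow_out_app.
by apply: eq_bigr => i _; rewrite ffunE.
Qed.

Lemma pow_addc (M : Mod C) n : addc M (power M n).
Proof.
pose del (i j : 'I_n) : Nat M M := if i == j then nat_id M else 0.
exists n, (fun i => pow_out (del i)), (fun i => pow_in (del i)).
apply: Nat_ext => X v; rewrite nat_sumE; apply/ffunP => i /=.
rewrite sum_ffunE (bigD1 i) //= !ffunE /pow_out_app (bigD1 i) //= /del eqxx /=.
rewrite !big1 ?addr0 // => j ne; rewrite ?ffunE.
  by rewrite (negPf ne) /=.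
by rewrite [in if _ then _ else _]eq_sym (negPf ne).
Qed.

(** The complement of [X] in a power of [M] is the kernel of the retraction. *)
Lemma in_addE (M X : Mod C) : in_add M X <-> addc M X.
Proof.
split=> [[Y [n [f [g [gf fg]]]]] | [n [a [b e]]]].
  apply: (addc_trans (pow_addc M n)).
  apply: (@retract_addc _ _ _ _ (f \oN sum_in (nat_id X) 0)
                                (sum_out (nat_id X) 0 \oN g)).
  apply: Nat_ext => Z x /=.
  have /= -> := nat_congr gf (x, 0 : Y Z); first by rewrite /sum_out_app /= addr0.
have ba : pow_out b \oN pow_in a = nat_id X by rewrite pow_out_in.
pose k := nat_id (power M n) - pow_in a \oN pow_out b.
have bk : pow_out b \oN k = 0.
  by rewrite nat_compBr nat_compA ba nat_comp1l nat_comp1r subrr.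
exists (ker (pow_out b)), n, (sum_out (pow_in a) (ker_inc _)),
  (sum_in (pow_out b) (ker_lift bk)); split; last first.
  by apply: Nat_ext => Z v; rewrite /= /sum_out_app /= /ker_inc_app /= addrC subrK.
apply: Nat_ext => Z [x y] /=; rewrite /sum_in_app /sum_out_app /=.
have y0 : pow_out_app b (ker_inc_app y) = 0 by apply/eqP/(valP y).
have bx : pow_out_app b (pow_in_app a x) = x := nat_congr ba x.
have xy : pow_out_app b (pow_in_app a x + ker_inc_app y) = x.
  by have /= -> := raddfD (pow_out b Z) (pow_in_app a x) (ker_inc_app y);
    rewrite bx y0 addr0.
by congr (_, _) => //; apply: val_inj; rewrite /= xy addrC addKr.
Qed.

End InAddP.

(** * Quotient functors *)

Section Quotient.
Variables (R : comPzRingType) (C : linCat R) (M : Mod C).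
Variables (S : forall X, set (M X)) (subS : subfunctor S).

Definition quo_pred X : {pred M X} := fun x => `[< S x >].
Fact quo_zmod_closed X : zmod_closed (@quo_pred X).
Proof.
have [S0 SB _] := subS; split=> [|x y]; rewrite !unfold_in; first exact/asboolP.
by move=> /asboolP Sx /asboolP Sy; apply/asboolP/SB.
Qed.
HB.instance Definition _ X :=
  GRing.isZmodClosed.Build (M X) (@quo_pred X) (@quo_zmod_closed X).
Definition quo_val X : zmodType := Quotient.quot (@quo_pred X).

Definition quo_pi X (x : M X) : quo_val X := \pi_(quo_val X)%qT x.

Lemma quo_piE X (x y : M X) : quo_pi x = quo_pi y <-> S (x - y).
Proof.
rewrite /quo_pi; split=> [/eqP|Sxy].
  by rewrite -Quotient.idealrBE => /asboolP.
by apply/eqP; rewrite -Quotient.idealrBE; apply/asboolP.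
Qed.

Lemma quo_piB X : zmod_morphism (@quo_pi X).
Proof. exact: raddfB. Qed.
HB.instance Definition _ X :=
  GRing.isZmodMorphism.Build (M X) (quo_val X) (@quo_pi X) (@quo_piB X).

Lemma quo_pi_surj X (x : quo_val X) : exists y, quo_pi y = x.
Proof. by exists (repr x); rewrite /quo_pi reprK. Qed.

Definition quo_map X Y (h : hom X Y) (x : quo_val X) : quo_val Y :=
  quo_pi (fmap M h (repr x)).

Lemma quo_mapE X Y (h : hom X Y) (x : M X) :
  quo_map h (quo_pi x) = quo_pi (fmap M h x).
Proof.
apply/quo_piE; rewrite -raddfB; have [_ _ Smap] := subS; apply: Smap.
by apply/quo_piE; rewrite /quo_pi reprK.
Qed.

Fact quo_map_is_zmod_morphism X Y (h : hom X Y) : zmod_morphism (quo_map h).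
Proof.
move=> x y; have [x' <-] := quo_pi_surj x; have [y' <-] := quo_pi_surj y.
by rewrite -raddfB !quo_mapE -raddfB -raddfB.
Qed.
HB.instance Definition _ X Y (h : hom X Y) :=
  GRing.isZmodMorphism.Build (quo_val X) (quo_val Y) (quo_map h)
    (quo_map_is_zmod_morphism h).

Fact quo_map1 X (x : quo_val X) : quo_map (idm X) x = x.
Proof. by have [y <-] := quo_pi_surj x; rewrite quo_mapE fmap1. Qed.
Fact quo_mapM X Y Z (g : hom Y Z) (h : hom X Y) (x : quo_val X) :
  quo_map (g \oC h) x = quo_map g (quo_map h x).
Proof. by have [y <-] := quo_pi_surj x; rewrite !quo_mapE fmapM. Qed.
Fact quo_mapD X Y (g h : hom X Y) (x : quo_val X) :
  quo_map (g + h) x = quo_map g x + quo_map h x.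
Proof. by have [y <-] := quo_pi_surj x; rewrite !quo_mapE fmapD raddfD. Qed.
Definition quo : Mod C :=
  @MkMod R C (fun X => quo_val X) (fun X Y h => quo_map h)
    quo_map1 quo_mapM quo_mapD.

Definition quo_proj : Nat M quo :=
  @MkNat R C M quo (fun X => @quo_pi X) (fun X Y h x => esym (quo_mapE h x)).
End Quotient.

Section Cokernel.
Variables (R : comPzRingType) (C : linCat R).

Lemma coker_exists (L M : Mod C) (f : Nat L M) :
  exists (K : Mod C) (q : Nat M K), nat_surj q /\ nat_exact f q.
Proof.
pose S X (y : M X) : Prop := exists x, f X x = y.
have subS : subfunctor S.
  split=> [X|X _ _ [x <-] [y <-]|X Y h _ [x <-]]; first by exists 0; rewrite raddf0.
    by exists (x - y); rewrite raddfB.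
  by exists (fmap L h x); rewrite natural.
exists (quo subS), (quo_proj subS); split=> [X y|X y]; first exact: quo_pi_surj.
have /= := quo_piE subS y 0; rewrite subr0 raddf0 => e; exact: e.
Qed.

Lemma surj_factor (M K N : Mod C) (q : Nat M K) (u : Nat M N) :
  nat_surj q -> (forall X x, q X x = 0 -> u X x = 0) ->
  exists v : Nat K N, v \oN q = u.
Proof.
move=> q_surj qu.
pose s X (y : K X) : M X := sval (cid (q_surj X y)).
have sK X y : q X (s X y) = y by rewrite /s; case: cid.
have us X x : u X (s X (q X x)) = u X x.
  by apply/eqP; rewrite -subr_eq0 -raddfB; apply/eqP/qu; rewrite raddfB sK subrr.
have vB X : zmod_morphism (fun y : K X => u X (s X y)).
  by move=> x y; rewrite -raddfB -[RHS]us raddfB !sK.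
have vN X Y (h : hom X Y) (x : K X) :
    u Y (s Y (fmap K h x)) = fmap N h (u X (s X x)).
  by rewrite -[x in LHS]sK -natural us natural.
by exists (mk_nat vB vN); apply: Nat_ext => X x /=; rewrite us.
Qed.

Lemma coker_exact_factor (L M K N : Mod C) (f : Nat L M) (q : Nat M K)
    (u : Nat M N) :
  nat_surj q -> nat_exact f q -> u \oN f = 0 ->
  exists v : Nat K N, v \oN q = u.
Proof.
move=> q_surj fq uf0; apply: surj_factor => // X x /fq [y <-].
exact: (nat_congr uf0 y).
Qed.

Lemma surj_cancel (M K N : Mod C) (q : Nat M K) (u v : Nat K N) :
  nat_surj q -> u \oN q = v \oN q -> u = v.
Proof.
move=> q_surj e; apply: Nat_ext => X x; have [y <-] := q_surj X x.
exact: (nat_congr e y).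
Qed.

Definition fin_gen (M : Mod C) : Prop :=
  exists (B : C) (e : Nat (yo B) M), nat_surj e.

Lemma fp_fin_gen (M : Mod C) : finitely_presented M -> fin_gen M.
Proof. by case=> C1 [C0 [d [e [_ es]]]]; exists C0, e. Qed.

Hypothesis addC : additive_category C.

Lemma yo_fp (X : C) : finitely_presented (yo X).
Proof.
have [[Z [_ Z0]] _] := addC.
exists Z, X, 0, (nat_id _); split; last by move=> Y y; exists y.
by move=> Y y; split=> [/= -> | [z <-]] //; exists 0.
Qed.

(** The relations of the cokernel are those of [M] together with lifts of the
    images of the generators of [L]; this uses direct sums in [C]. *)
Lemma fp_coker (L M K : Mod C) (f : Nat L M) (q : Nat M K) :
  fin_gen L -> finitely_presented M -> nat_surj q -> nat_exact f q ->
  finitely_presented K.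
Proof.
move=> [B [e' e's]] [C1 [C0 [d [e [de es]]]]] qs fq.
have [y ey] := es B (f B (e' B (idm B))).
have [_ biprod] := addC.
have [S [i1 [i2 [p1 [p2 [pi1 pi2 p12 p21 _]]]]]] := biprod C1 B.
pose c := d C1 (idm C1).
have [del delE] : exists del : Nat (yo S) (yo C0), forall Z (z : yo S Z),
    del Z z = d Z ((z : hom S Z) \oC i1 : yo C1 Z) + (z \oC i2 \oC y : hom C0 Z).
  exists (yoel (i1 \oC c + i2 \oC y : yo C0 S)) => Z z.
  by rewrite (nat_yoE d) /= /yoel_app /= /post compDr !compA.
have ey' Z (w : hom B Z) : e Z (w \oC y : yo C0 Z) = f Z (e' Z w).
  by rewrite (natural e w y) ey -!natural /= /post compm1.
exists S, C0, del, (q \oN e); split; last first.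
  move=> Z z; have [m <-] := qs Z z; have [x <-] := es Z m; by exists x.
move=> Z x; split=> [/= /fq [l] | [z <-]].
  have [w <-] := e's Z l; rewrite -ey' => exw.
  have /de [v dv] : e Z (x - (w \oC y : hom C0 Z) : yo C0 Z) = 0.
    by rewrite raddfB exw subrr.
  exists ((v : hom C1 Z) \oC p1 + w \oC p2 : hom S Z).
  rewrite delE [_ \oC i1]compDl [_ \oC i2]compDl -!(compA _ p1) -!(compA _ p2).
  by rewrite p12 p21 pi1 pi2 !comp0r addr0 add0r !compm1 dv subrK.
rewrite /= delE raddfD ey'; apply/fq.
exists (e' Z ((z : hom S Z) \oC i2 : hom B Z)).
have /= : e Z (d Z ((z : hom S Z) \oC i1 : yo C1 Z)) = 0 by apply/de; eexists.
by move=> ->; rewrite add0r.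
Qed.

Lemma coker_fp (L M : fpMod C) (f : Nat L M) :
  exists (K : fpMod C) (q : Nat M K), nat_surj q /\ nat_exact f q.
Proof.
have [K [q [qs fq]]] := coker_exists f.
have Kfp := fp_coker (fp_fin_gen (fpmodP L)) (fpmodP M) qs fq.
by exists (MkFpMod Kfp), q.
Qed.

Definition yofp (X : C) : fpMod C := MkFpMod (yo_fp X).

(** The cokernel of [f] is finitely presented, so pointwise surjectivity is the
    categorical notion of epimorphism inside mod C, and dualities respect it. *)
Lemma eq0_cancel_surj (M N : fpMod C) (f : Nat M N) :
  (forall (K : fpMod C) (g : Nat N K), g \oN f = 0 -> g = 0) -> nat_surj f.
Proof.
move=> fcan; have [K [q [qs fq]]] := coker_fp f.
move=> X y; apply/fq; suff -> : q = 0 by [].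
by apply: fcan; apply: Nat_ext => Z z /=; apply/fq; exists z.
Qed.

Lemma biproduct (X : C) n : exists (S : C) (i : 'I_n -> hom X S)
    (p : 'I_n -> hom S X),
  (forall j k, p j \oC i k = if j == k then idm X else 0) /\
  \sum_j (i j \oC p j) = idm S.
Proof.
have [[Z [Z0 Z0']] biprod] := addC.
elim: n => [|n [S [i [p [pi ip]]]]].
  by exists Z, (fun=> 0), (fun=> 0); split=> [[]//|]; rewrite big_ord0 [RHS]Z0.
have [T [i1 [i2 [p1 [p2 [pi1 pi2 p12 p21 e]]]]]] := biprod X S.
exists T, (fun j => if unlift ord0 j is Some k then i2 \oC i k else i1),
  (fun j => if unlift ord0 j is Some k then p k \oC p2 else p1); split.
  move=> j k.
  case: (unliftP ord0 j) => [j'|] ->; case: (unliftP ord0 k) => [k'|] ->.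
  - rewrite -compA [p2 \oC _]compA pi2 comp1m pi.
    by rewrite (inj_eq (@lift_inj _ ord0)).
  - by rewrite -compA p21 comp0r.
  - by rewrite compA p12 comp0l.
  - by rewrite pi1 eqxx.
rewrite big_ord_recl unlift_none -e; congr (_ + _).
rewrite -[X in X \oC p2]compm1 -ip comp_sumr comp_suml; apply: eq_bigr => j _.
by rewrite liftK !compA.
Qed.

End Cokernel.

(** * Kernels *)

Section Kernels.
Variables (R : comPzRingType) (C : linCat R).

(** Applied once more to the covering of the kernel, this finite generation
    makes the kernel finitely presented: mod C is then closed under kernels in
    the category of all additive functors. *)
Definition fg_kernels : Prop :=
  forall (M N : fpMod C) (f : Nat M N),
  exists (Z : C) (k : Nat (yo Z) M), nat_exact k f.

(** The same property for the opposite category, on representable functors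
    only. *)
Definition weak_kernels : Prop :=
  forall (X Y : C) (f : hom X Y), exists (Z : C) (g : hom Z X),
    f \oC g = 0 /\
    forall W (h : hom W X), f \oC h = 0 -> exists h' : hom W Z, g \oC h' = h.
End Kernels.

Section KernelsOp.
Variables (R : comPzRingType) (C : linCat R).

Lemma additive_op : additive_category C -> additive_category (opcat C).
Proof.
move=> [[Z [Z0 Z0']] biprod]; split; first by exists Z.
move=> X Y; have [S [i1 [i2 [p1 [p2 [? ? ? ? ?]]]]]] := biprod X Y.
by exists S, p1, p2, i1, i2; split.
Qed.

Lemma fg_kernels_weak_kernels_op : additive_category C ->
  fg_kernels C -> weak_kernels (opcat C).
Proof.
move=> addC kers X Y f.
have [Z [k kf]] := kers (yofp addC X) (yofp addC Y) (yoel (f : yo (Y : C) X)).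
exists Z, (k Z (idm Z)); split; first by apply/(kf Z); exists (idm Z).
move=> W h fh0; have /kf [h' <-] : yoel (f : yo (Y : C) X) W h = 0 := fh0.
by exists h'; exact: (esym (nat_yoE k h')).
Qed.

Lemma fg_kernels_op_weak_kernels : additive_category C ->
  fg_kernels (opcat C) -> weak_kernels C.
Proof.
move=> addC kers X Y f; have addC' := additive_op addC.
pose yf : Nat (yo (X : opcat C)) (yo (Y : opcat C)) :=
  yoel (f : yo (Y : opcat C) (X : opcat C)).
have [Z [k kf]] := kers (yofp addC' X) (yofp addC' Y) yf.
exists Z, (k Z (idm Z)); split; first by apply/(kf Z); exists (idm Z).
move=> W h fh0; have /kf [h' <-] : yf W h = 0 := fh0.
by exists h'; exact: (esym (nat_yoE k h')).
Qed.
End KernelsOp.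

(** * Flatness of hom(A, X) over End(A) *)

Section Flatness.
Variables (R : comPzRingType) (C : linCat R).

(** The equational criterion for flatness of the right [End(A)]-module
    [hom A X]: every relation between elements is a consequence of relations
    between scalars. *)
Definition flat_at (A X : C) : Prop :=
  forall m l (a : 'I_m -> 'I_l -> hom A A) (x : 'I_m -> hom A X),
    (forall j, \sum_i (x i \oC a i j) = 0) ->
    exists n (p : 'I_n -> hom A X) (y : 'I_n -> 'I_m -> hom A A),
      (forall i, x i = \sum_t (p t \oC y t i)) /\
      (forall t j, \sum_i (y t i \oC a i j) = 0).

(** Finitely generated projective modules are the summands of finite free
    modules; [p] and [phi] are the two halves of such a splitting. *)
Definition dual_basis (A X : C) : Prop :=
  exists n (p : 'I_n -> hom A X) (phi : 'I_n -> hom A X -> hom A A),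
    [/\ forall t, zmod_morphism (phi t),
        forall t x (b : hom A A), phi t (x \oC b) = phi t x \oC b &
        forall x, x = \sum_t (p t \oC phi t x)].

Lemma dual_basis_flat (A X : C) : dual_basis A X -> flat_at A X.
Proof.
move=> [n [p [phi [phiB phiM pphi]]]] m l a x xa0.
exists n, p, (fun t i => phi t (x i)); split=> [i|t j]; first exact: pphi.
have := raddf_sum (additive_fun (phiB t)) _ predT (fun i => x i \oC a i j).
move=> /= e; transitivity (phi t (\sum_i (x i \oC a i j))).
  by rewrite e; apply: eq_bigr => i _; rewrite phiM.
by rewrite xa0; exact: (raddf0 (additive_fun (phiB t))).
Qed.

(** A finitely presented flat module is projective. Weak kernels make the
    relations between the generators [x] a finitely generated module; the
    equational criterion applied to a generating family [a] of relations
    factors the presentation through a finite free module. *)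
Lemma flat_dual_basis (A X : C) :
  additive_category C -> weak_kernels C ->
  (forall Z : C, finitely_generated (hom A Z)) ->
  flat_at A X -> dual_basis A X.
Proof.
move=> addC wker fgA flatX.
have [m [x xgen]] := fgA X.
have [S [inj [prj [prjinj injprj]]]] := biproduct addC A m.
pose f : hom S X := \sum_i (x i \oC prj i).
have f_inj i : f \oC inj i = x i.
  rewrite /f comp_suml (bigD1 i) //= big1 => [|j ne].
    by rewrite -compA prjinj eqxx compm1 addr0.
  by rewrite -compA prjinj (negPf ne) comp0r.
have [Z [g [fg0 gker]]] := wker _ _ f.
have [l [z zgen]] := fgA Z.
pose a i j := prj i \oC (g \oC z j).
have xa0 j : \sum_i (x i \oC a i j) = 0.
  transitivity (f \oC g \oC z j); last by rewrite fg0 comp0l.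
  by rewrite /f !comp_suml; apply: eq_bigr => i _; rewrite /a !compA.
have [n [p [y [xpy ya0]]]] := flatX _ _ _ _ xa0.
have lam_ex (u : hom A X) :
    exists lam : 'I_m -> hom A A, u = \sum_i (x i \oC lam i).
  have [r ->] := xgen u; exists (fun i => r i *: idm A).
  by apply: eq_bigr => i _; rewrite compZr compm1.
pose lam u := sval (cid (lam_ex u)).
have lamE u : u = \sum_i (x i \oC lam u i) by rewrite /lam; case: cid.
pose phi t u := \sum_i (y t i \oC lam u i).
(* Every relation kills the coordinates [phi], which are thus well defined. *)
have rel0 t (mu : 'I_m -> hom A A) :
    \sum_i (x i \oC mu i) = 0 -> \sum_i (y t i \oC mu i) = 0.
  move=> xmu; have : f \oC (\sum_i (inj i \oC mu i)) = 0.
    by rewrite comp_sumr -[RHS]xmu; apply: eq_bigr => i _; rewrite compA f_inj.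
  move=> /gker [h' gh']; have [r h'r] := zgen h'.
  have muE i : mu i = \sum_j r j *: a i j.
    transitivity (prj i \oC (g \oC h')).
      rewrite gh' comp_sumr (bigD1 i) //= big1 => [|j ne].
        by rewrite compA prjinj eqxx comp1m addr0.
      by rewrite compA prjinj eq_sym (negPf ne) comp0l.
    by rewrite h'r !comp_sumr; apply: eq_bigr => j _; rewrite !compZr.
  transitivity (\sum_i \sum_j r j *: (y t i \oC a i j)).
    apply: eq_bigr => i _; rewrite muE comp_sumr.
    by apply: eq_bigr => j _; rewrite compZr.
  rewrite exchange_big big1 // => j _.
  by rewrite -scaler_sumr ya0 scaler0.
have phiE t u (mu : 'I_m -> hom A A) :
    u = \sum_i (x i \oC mu i) -> phi t u = \sum_i (y t i \oC mu i).
  move=> umu; apply/eqP; rewrite -subr_eq0 -sumrB; apply/eqP.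
  rewrite -[RHS](rel0 t (fun i => lam u i - mu i)); last first.
    rewrite -[RHS](subrr u) {1}[in RHS](lamE u) [in X in _ - X]umu -sumrB.
    by apply: eq_bigr => i _; rewrite compDr compNr.
  by apply: eq_bigr => i _; rewrite compDr compNr.
exists n, p, phi; split=> [t u v|t u b|u].
- rewrite (phiE t _ (fun i => lam u i - lam v i)).
    by rewrite -sumrB; apply: eq_bigr => i _; rewrite compDr compNr.
  rewrite {1}(lamE u) {1}(lamE v) -sumrB.
  by apply: eq_bigr => i _; rewrite compDr compNr.
- rewrite (phiE t _ (fun i => lam u i \oC b)).
    by rewrite comp_suml; apply: eq_bigr => i _; rewrite compA.
  by rewrite {1}(lamE u) comp_suml; apply: eq_bigr => i _; rewrite compA.
rewrite {1}(lamE u).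
transitivity (\sum_i \sum_t (p t \oC (y t i \oC lam u i))).
  apply: eq_bigr => i _; rewrite xpy comp_suml.
  by apply: eq_bigr => t _; rewrite compA.
by rewrite exchange_big; apply: eq_bigr => t _; rewrite comp_sumr.
Qed.

(** Membership in the trace of [hom(A, -)] in the kernel of [f], the subfunctor
    generated by the value of that kernel at [A]. *)
Definition in_trace (A : C) (M N : Mod C) (f : Nat M N) Z (k : M Z) : Prop :=
  exists (I : finType) (p : I -> hom A Z) (y : I -> M A),
    (forall t, f A (y t) = 0) /\ k = \sum_t fmap M (p t) (y t).

Lemma in_traceB (A : C) (M N : Mod C) (f : Nat M N) Z (k k' : M Z) :
  in_trace A f k -> in_trace A f k' -> in_trace A f (k - k').
Proof.
move=> [I [p [y [fy ->]]]] [I' [p' [y' [fy' ->]]]].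
exists (I + I')%type, (fun s => match s with inl t => p t | inr t => - p' t end),
  (fun s => match s with inl t => y t | inr t => y' t end); split=> [[]//|].
rewrite big_sumType /=; congr (_ + _); rewrite -sumrN.
by apply: eq_bigr => t _; rewrite fmapN.
Qed.

Lemma in_trace_addc (A : C) (Q M N : Mod C) (v : Nat Q M) (f : Nat M N) Z
    (q : Q Z) :
  addc (yo A) Q -> f \oN v = 0 -> in_trace A f (v Z q).
Proof.
move=> [n [a [b e]]] fv0.
exists 'I_n, (fun i => a i Z q : hom A Z), (fun i => v A (b i A (idm A))).
split=> [t|]; first exact: (nat_congr fv0).
rewrite {1}(addcE e q) raddf_sum; apply: eq_bigr => i _.
by rewrite (nat_yoE (b i)) natural.
Qed.

(** After embedding [M] and [N] in powers of [hom(A, -)], the map [f] becomes a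
    matrix and [f k = 0] a relation in [hom A Z], to which flatness applies. *)
Lemma flat_in_trace (A : C) (M N : Mod C) (f : Nat M N) Z (k : M Z) :
  flat_at A Z -> addc (yo A) M -> addc (yo A) N -> f Z k = 0 ->
  in_trace A f k.
Proof.
move=> flatZ [m [a [b e]]] [l [a' [b' e']]] fk0.
pose al i j : hom A A := (a' j \oN f \oN b i) A (idm A).
have alE i j W (x : hom A W) : (a' j \oN f \oN b i) W x = x \oC al i j.
  exact: nat_yoE.
have rel j : \sum_i ((a i Z k : hom A Z) \oC al i j) = 0.
  rewrite -[RHS](raddf0 (a' j Z)) -fk0 {2}(addcE e k) !raddf_sum.
  by apply: eq_bigr => i _; rewrite -alE.
have [n [p [y [apy yal0]]]] := flatZ _ _ _ _ rel.
exists 'I_n, p, (fun t => \sum_i b i A (y t i)); split=> [t|].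
  rewrite (addcE e' (f A _)) big1 // => j _.
  suff -> : a' j A (f A (\sum_i b i A (y t i))) = 0 by rewrite raddf0.
  rewrite !raddf_sum -[RHS](yal0 t j); apply: eq_bigr => i _.
  by rewrite -alE.
rewrite {1}(addcE e k).
transitivity (\sum_i \sum_t fmap M (p t) (b i A (y t i))).
  apply: eq_bigr => i _; rewrite apy raddf_sum.
  by apply: eq_bigr => t _; rewrite -natural.
by rewrite exchange_big; apply: eq_bigr => t _; rewrite raddf_sum.
Qed.

End Flatness.

(** * Presentations and resolutions by add(P) *)

Section Resolutions.
Variables (R : comPzRingType) (C : linCat R).

Section Build.
Variable good : fpMod C -> Prop.

(** Two consecutive terms of a resolution. The next stage has the source of
    [stage_map] as its target by definition, which makes the maps of the
    resulting sequence composable without casts. *)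
Record stage := Stage {
  stage_src : fpMod C;
  stage_tgt : fpMod C;
  stage_map : Nat stage_src stage_tgt;
  stage_src_good : good stage_src;
  stage_tgt_good : good stage_tgt
}.

Hypothesis step : forall (M N : fpMod C) (f : Nat M N), good M -> good N ->
  exists (L : fpMod C) (g : Nat L M), good L /\ nat_exact g f.

Lemma next_stageP (s : stage) : exists (L : fpMod C) (g : Nat L (stage_src s)),
  good L /\ nat_exact g (stage_map s).
Proof. exact: step (stage_src_good s) (stage_tgt_good s). Qed.

Definition next_stage (s : stage) : stage :=
  let L := cid (next_stageP s) in let g := cid (svalP L) in
  Stage (sval g) (proj1 (svalP g)) (stage_src_good s).

Lemma next_stage_exact s :
  nat_exact (stage_map (next_stage s) : Nat _ (stage_src s)) (stage_map s).
Proof. exact: (proj2 (svalP (cid (svalP (cid (next_stageP s)))))). Qed.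

(** The predicate [S] expresses that the first two terms are kept, without an
    equality between functors. *)
Lemma extend_resolution (X Q0 Q1 : fpMod C) (e : Nat Q0 X) (d : Nat Q1 Q0) :
  good Q0 -> good Q1 -> nat_surj e -> nat_exact d e ->
  exists (Q : nat -> fpMod C) (e' : Nat (Q 0%N) X)
         (d' : forall i, Nat (Q i.+1) (Q i)),
    [/\ forall i, good (Q i), nat_surj e', nat_exact (d' 0%N) e',
        forall i, nat_exact (d' i.+1) (d' i) &
        forall S : fpMod C -> Prop, S Q0 -> S Q1 -> S (Q 0%N) /\ S (Q 1%N)].
Proof.
move=> Q0g Q1g es de.
pose st i := iter i next_stage (Stage d Q1g Q0g).
exists (fun i => stage_tgt (st i)), e, (fun i => stage_map (st i)).
split=> // i; first exact: stage_tgt_good.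
exact: next_stage_exact.
Qed.
End Build.

Hypothesis addC : additive_category C.
Hypothesis kers : fg_kernels C.
Variable A : C.

Lemma addc_yo_biproduct n (S : C) (i : 'I_n -> hom A S) (p : 'I_n -> hom S A) :
  \sum_j (i j \oC p j) = idm S -> addc (yo A) (yo S).
Proof.
move=> ip; exists n, (fun j => yoel (i j : yo A S)),
  (fun j => yoel (p j : yo S A)).
apply: yoneda_ext; rewrite nat_sumE -[RHS]ip; apply: eq_bigr => j _.
by rewrite /= /yoel_app /= /post /= comp1m.
Qed.

Lemma addc_projective (Q : fpMod C) : addc (yo A) Q -> projective Q.
Proof.
by move=> AQ; apply/exproj_projective/(exproj_addc AQ)/exproj_yo.
Qed.

(** The kernel of a map in add(P) has one generator [k] by [fg_kernels]. By
    flatness [k] is a combination of finitely many elements [y] of the kernel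
    at [A], so that the kernel is covered by a finite power of P. *)
Lemma flat_PP (X : fpMod C) :
  (forall Z, flat_at A Z) -> PP (yo A) (Some 1%N) X -> PP (yo A) None X.
Proof.
move=> flatA [Q [e [d [Qp es d0e dd Qadd]]]].
have step (M N : fpMod C) (f : Nat M N) : addc (yo A) M -> addc (yo A) N ->
    exists (L : fpMod C) (g : Nat L M), addc (yo A) L /\ nat_exact g f.
  move=> AM AN; have [Z [k kf]] := kers f.
  have fk0 : f Z (k Z (idm Z)) = 0 by apply/kf; eexists.
  have [I [p [y [fy kpy]]]] := flat_in_trace (flatA Z) AM AN fk0.
  have [S [i [q [qi iq]]]] := biproduct addC A #|I|.
  exists (yofp addC S), (yoel (\sum_t fmap M (i (enum_rank t)) (y t))).
  split; first exact: addc_yo_biproduct iq.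
  move=> W z; split=> [/kf [h <-] | [h <-]].
    exists (\sum_t ((h : hom Z W) \oC p t \oC q (enum_rank t)) : hom S W).
    rewrite (nat_yoE k) kpy /= /yoel_app !raddf_sum; apply: eq_bigr => t _.
    rewrite -!fmapM comp_suml (bigD1 t) //= big1 => [|s ne].
      by rewrite -compA qi eqxx compm1 addr0.
    by rewrite -compA qi (inj_eq enum_rank_inj) (negPf ne) comp0r.
  rewrite natural raddf_sum big1 ?raddf0 // => t _.
  by rewrite natural fy raddf0.
have add0 : addc (yo A) (Q 0%N) by apply/in_addE/Qadd.
have add1 : addc (yo A) (Q 1%N) by apply/in_addE/Qadd.
have [Q' [e' [d' [Qa' es' de' dd' _]]]] := extend_resolution step add0 add1 es d0e.
exists Q', e', d'; split=> // i; first exact: addc_projective.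
by move=> _; apply/in_addE.
Qed.

(** The presentation [d] of the cokernel [X] of the matrix [a] is compared with
    a resolution [Q] of [X] by add(P). The composite of the comparison maps
    [th1] and [be1] differs from the identity by a homotopy [s] and a map [tau]
    into the kernel of [d]. An element [k] of that kernel is thus a difference
    of the values of two maps from functors in add(P) to the kernel, and such
    values lie in the trace. *)
Lemma PP_flat :
  (forall X : fpMod C, PP (yo A) (Some 1%N) X -> PP (yo A) None X) ->
  forall Z, flat_at A Z.
Proof.
move=> PPA Z m l a x xa0.
have [S1 [i1 [p1 [pi1 ip1]]]] := biproduct addC A m.
have [S0 [i0 [p0 [pi0 ip0]]]] := biproduct addC A l.
have AS1 := addc_yo_biproduct ip1; have AS0 := addc_yo_biproduct ip0.
pose al : hom S0 S1 := \sum_i \sum_j (i1 i \oC a i j \oC p0 j).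
have compal W (w : hom S1 W) j :
    w \oC al \oC i0 j = \sum_i (w \oC i1 i \oC a i j).
  rewrite comp_sumr comp_suml; apply: eq_bigr => i _.
  rewrite comp_sumr comp_suml (bigD1 j) //= big1 => [|k ne].
    by rewrite -!compA pi0 eqxx compm1 addr0.
  by rewrite -!compA pi0 (negPf ne) !comp0r.
have [d dE] : exists d : Nat (yofp addC S1) (yofp addC S0),
    forall W (w : hom S1 W), d W w = w \oC al.
  by exists (yoel (al : yo S0 S1)).
have [X [e [es de]]] := coker_fp addC d.
have /PPA [Q [e' [d' [_ es' de' dd' Qadd]]]] : PP (yo A) (Some 1%N) X.
  pose good (Q : fpMod C) := exproj Q.
  have step (M N : fpMod C) (f : Nat M N) : good M -> good N ->
      exists (L : fpMod C) (g : Nat L M), good L /\ nat_exact g f.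
    move=> _ _; have [W [k kf]] := kers f.
    by exists (yofp addC W), k; split=> //; exact: exproj_yo.
  have [Q [e' [d' [Qg es' de' dd' QS]]]] :=
    extend_resolution step (@exproj_yo _ _ S0 : good (yofp addC S0))
      (@exproj_yo _ _ S1 : good (yofp addC S1)) es de.
  exists Q, e', d'; split=> // [i|]; first exact/exproj_projective/Qg.
  have [Q0 Q1] := QS (fun Q : fpMod C => in_add (yo A) Q)
    (iffRL (in_addE _ _) AS0) (iffRL (in_addE _ _) AS1).
  by move=> [|[|i]].
have AQ i : addc (yo A) (Q i) by apply/in_addE/Qadd.
have Qp i := exproj_addc (AQ i) (@exproj_yo _ _ A).
have [th0 th0E] := exproj_surj e (@exproj_yo _ _ S0) es'.
have [be0 be0E] := exproj_surj e' (Qp 0%N) es.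
have ed0 : e \oN d = 0 by apply: nat_eq0P => W w /=; apply/de; exists w.
have ed0' : e' \oN d' 0%N = 0 by apply: nat_eq0P => W w /=; apply/de'; exists w.
have dd0' : d' 0%N \oN d' 1%N = 0.
  by apply: nat_eq0P => W w /=; apply/dd'; exists w.
have [th1 th1E] : exists th1, d' 0%N \oN th1 = th0 \oN d.
  by apply: (@exproj_yo _ _ S1) de' _ _; rewrite nat_compA th0E.
have [be1 be1E] : exists be1, d \oN be1 = be0 \oN d' 0%N.
  by apply: (Qp 1%N) de _ _; rewrite nat_compA be0E.
have [s sE] : exists s, d \oN s = be0 \oN th0 - nat_id (yo S0).
  apply: (@exproj_yo _ _ S0) de _ _.
  by rewrite nat_compBr nat_compA be0E th0E nat_comp1r subrr.
pose tau := be1 \oN th1 - nat_id (yo S1) - s \oN d.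
have dtau : d \oN tau = 0.
  rewrite !nat_compBr !nat_compA be1E sE nat_compBl -!nat_compA th1E.
  by rewrite nat_comp1r nat_comp1l subrr.
pose k : hom S1 Z := \sum_i (x i \oC p1 i).
have ki1 i : k \oC i1 i = x i.
  rewrite comp_suml (bigD1 i) //= big1 => [|j ne].
    by rewrite -compA pi1 eqxx compm1 addr0.
  by rewrite -compA pi1 (negPf ne) comp0r.
have kal0 : k \oC al = 0.
  rewrite -[k \oC al]compm1 -ip0 comp_sumr big1 // => j _.
  rewrite compA compal (eq_bigr (fun i => x i \oC a i j)) => [|i _].
    by rewrite xa0 comp0l.
  by rewrite ki1.
have [q qE] : exists q, d' 1%N Z q = th1 Z k.
  apply/dd'; have /= -> := nat_congr th1E (k : yo S1 Z).
  by rewrite dE kal0 raddf0.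
have kE : k = (be1 \oN d' 1%N) Z q - tau Z k :> yo S1 Z.
  by rewrite /= qE /= dE kal0 raddf0 subr0 opprB addrC subrK.
have : in_trace A d (k : yo S1 Z).
  rewrite kE; apply: in_traceB; apply: in_trace_addc => //.
  by rewrite nat_compA be1E -nat_compA dd0' nat_comp0r.
move=> [I [p [y [dy kpy]]]].
exists #|I|, (fun t => p (enum_val t)),
  (fun t i => (y (enum_val t) : hom S1 A) \oC i1 i); split=> [i|t j].
  rewrite -ki1 (kpy : k = _) comp_suml (reindex (@enum_val I I)) /=.
    by apply: eq_bigr => t _; rewrite compA.
  exact/onW_bij/enum_val_bij.
by rewrite -compal -dE dy comp0l.
Qed.

Lemma PP_iff_flat :
  (forall X : fpMod C, PP (yo A) (Some 1%N) X <-> PP (yo A) None X) <->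
  (forall Z, flat_at A Z).
Proof.
split=> [PPA|flatA X]; first by apply: PP_flat => X /PPA.
split; first exact: flat_PP.
by move=> [Q [e [d [? ? ? ? Qadd]]]]; exists Q, e, d; split=> // i _; exact: Qadd.
Qed.

End Resolutions.

(** * Finitely generated projective modules *)

Section DualBasis.
Variable S : pzRingType.

Definition linear_fun (U V : lmodType S) (f : U -> V) of linear f := f.
Arguments linear_fun {U V f} _ /.
HB.instance Definition _ (U V : lmodType S) (f : U -> V) (fl : linear f) :=
  GRing.isLinear.Build S U V *:%R (linear_fun fl) fl.

Lemma projective_dual_basis (U : lmodType S) n (v : 'I_n -> U) :
  (forall u, exists a : 'I_n -> S, u = \sum_i a i *: v i) ->
  projective_module U ->
  exists phi : 'I_n -> {linear U -> S^o},
    forall u, u = \sum_i (phi i u : S) *: v i.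
Proof.
move=> vgen Up.
pose g (a : {ffun 'I_n -> S^o}) : U := \sum_i (a i : S) *: v i.
have gl : linear g.
  move=> r a b; rewrite /g scaler_sumr -big_split; apply: eq_bigr => i _ /=.
  by rewrite !ffunE scalerDl scalerA.
have gsurj u : exists a, linear_fun gl a = u.
  have [a ->] := vgen u; exists [ffun i => a i].
  by apply: eq_bigr => i _; rewrite ffunE.
have [h gh] := Up _ _ (linear_fun gl) idfun gsurj.
have phil i : linear (fun u => h u i : S^o) by move=> r x y; rewrite linearP !ffunE.
by exists (fun i => linear_fun (phil i)) => u; rewrite -[u in LHS]gh.
Qed.

Lemma dual_basis_projective (U : lmodType S) n (v : 'I_n -> U)
    (phi : 'I_n -> {linear U -> S^o}) :
  (forall u, u = \sum_i (phi i u : S) *: v i) -> projective_module U.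
Proof.
move=> vphi M N g f gs.
pose m i := sval (cid (gs (f (v i)))).
have gm i : g (m i) = f (v i) by rewrite /m; case: cid.
have hl : linear (fun u => \sum_i (phi i u : S) *: m i).
  move=> r x y; rewrite scaler_sumr -big_split; apply: eq_bigr => i _ /=.
  by rewrite linearP scalerDl scalerA.
exists (linear_fun hl) => u; rewrite /= linear_sum [u in RHS]vphi linear_sum.
by apply: eq_bigr => i _; rewrite !linearZ gm.
Qed.

End DualBasis.

Section ProjectiveValues.
Variables (R : comPzRingType) (C : linCat R) (A : C).

(** By Yoneda's lemma [RP (yo A)] is [End(A)], acting on [hom A X] by
    precomposition. *)
Lemma projective_Value (X : C) :
  finitely_generated (hom A X) ->
  (projective_module (Value (yo A) X) <-> dual_basis A X).
Proof.
have scaleE (r : (RP (yo A))^c) (x : Value (yo A) X) :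
    r *: x = (x : hom A X) \oC (r : Nat (yo A) (yo A)) A (idm A).
  exact: nat_yoE.
move=> [n [v vgen]]; split=> [Vp|[m [p [phi [phiB phiM pphi]]]]].
  have [u|phi vphi] := @projective_dual_basis _ (Value (yo A) X) n v _ Vp.
    have [a ->] := vgen u; exists (fun i => yoel (a i *: idm A : yo A A)).
    apply: eq_bigr => i _.
    by rewrite scaleE /= /yoel_app /= /post !compZr !compm1.
  exists n, v, (fun i x => (phi i x : Nat (yo A) (yo A)) A (idm A)).
  split=> [i x y|i x b|x]; first by rewrite raddfB.
    have -> : x \oC b = (yoel (b : yo A A) : (RP (yo A))^c) *:
        (x : Value (yo A) X).
      by rewrite scaleE /= /yoel_app /= /post comp1m.
    by rewrite linearZ.
  by rewrite {1}[x]vphi; apply: eq_bigr => i _; rewrite scaleE.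
have phil i : linear (fun x : Value (yo A) X =>
    (yoel (phi i x : yo A A) : ((RP (yo A))^c)^o)).
  move=> r x y; apply: yoneda_ext; rewrite scaleE.
  transitivity (phi i (x : hom A X) \oC (r : Nat _ _) A (idm A) + phi i y).
    rewrite -phiM /= /yoel_app /= /post comp1m.
    exact: (raddfD (additive_fun (phiB i))).
  rewrite /= /yoel_app /= /post !comp1m; congr (_ + _).
  exact: (esym (nat_yoE (r : Nat (yo A) (yo A)) (phi i x : yo A A))).
apply: (@dual_basis_projective _ (Value (yo A) X) m p
  (fun i => linear_fun (phil i))) => u.
rewrite {1}[u]pphi; apply: eq_bigr => i _.
by rewrite scaleE /= /yoel_app /= /post comp1m.
Qed.

(** Here [Hom(P, hom(X, -))] is [hom X A], on which [End(A)] acts by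
    postcomposition. *)
Lemma projective_HomFrom (X : C) :
  finitely_generated (hom X A) ->
  (projective_module (HomFrom (yo A) (yo X)) <->
   dual_basis (A : opcat C) (X : opcat C)).
Proof.
pose ev (f : HomFrom (yo A) (yo X)) : hom X A := (f : Nat _ _) A (idm A).
pose el (x : hom X A) : HomFrom (yo A) (yo X) := yoel (x : yo X A).
have elK x : ev (el x) = x := yoel_id (x : yo X A).
have evI f g : ev f = ev g -> f = g := @yoneda_ext _ _ A (yo X) f g.
have evB : zmod_morphism ev by [].
have evS I (s : seq I) F : ev (\sum_(i <- s) F i) = \sum_(i <- s) ev (F i).
  exact: (raddf_sum (additive_fun evB)).
have scaleE (r : RP (yo A)) f :
    ev (r *: f) = (r : Nat (yo A) (yo A)) A (idm A) \oC ev f.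
  exact: (nat_yoE (f : Nat (yo A) (yo X)) ((r : Nat _ _) A (idm A))).
move=> [n [v vgen]]; split=> [Vp|[m [p [phi [phiB phiM pphi]]]]].
  have [f|phi vphi] := @projective_dual_basis _ _ n (fun i => el (v i)) _ Vp.
    have [a fa] := vgen (ev f); exists (fun i => yoel (a i *: idm A : yo A A)).
    apply: evI; rewrite fa evS; apply: eq_bigr => i _.
    by rewrite scaleE elK /= /yoel_app /= /post comp1m compZl comp1m.
  exists n, v, (fun i x => (phi i (el x) : Nat (yo A) (yo A)) A (idm A)).
  split=> [i x y|i x b|x].
  - have -> : el (x - y) = el x - el y by apply: evI; rewrite evB !elK.
    by rewrite raddfB.
  - have -> : el (x \oC b) = (yoel (b : yo A A) : RP (yo A)) *: el x.
      by apply: evI; rewrite scaleE !elK /= /yoel_app /= /post comp1m.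
    rewrite linearZ /= /yoel_app fmap1.
    exact: (nat_yoE (phi i (el x) : Nat (yo A) (yo A)) (b : yo A A)).
  rewrite -[LHS]elK {1}(vphi (el x)) evS; apply: eq_bigr => i _.
  by rewrite scaleE elK.
have phil i : linear (fun f => yoel (phi i (ev f) : yo A A) : (RP (yo A))^o).
  move=> r f g; apply: yoneda_ext.
  transitivity ((r : Nat _ _) A (idm A) \oC phi i (ev f) + phi i (ev g)).
    rewrite [LHS]yoel_id [ev _]/(ev (r *: f) + ev g) scaleE.
    have phiM' b x : phi i (b \oC x : hom X A) = b \oC (phi i x : hom A A).
      exact: phiM.
    rewrite -phiM'.
    exact: (raddfD (additive_fun (phiB i))).
  by rewrite -[in LHS](yoel_id (phi i (ev g) : yo A A)); congr (_ + _);
    rewrite /= /yoel_app /= /post comp1m.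
apply: (@dual_basis_projective _ _ m (fun i => el (p i))
  (fun i => linear_fun (phil i))) => f.
apply: evI; rewrite {1}(pphi (ev f)) evS; apply: eq_bigr => i _.
by rewrite scaleE elK /= /yoel_app /= /post comp1m.
Qed.

(** Yoneda's isomorphism between [P(X)] and [Hom(Hom(X, -), P)]. *)
Lemma yoneda_Value (X : C) :
  exists phi : {linear Value (yo A) X -> HomTo (yo X) (yo A)}, bijective phi.
Proof.
have yl : linear
    (fun x : Value (yo A) X => yoel (x : yo A X) : HomTo (yo X) (yo A)).
  by move=> r x y; apply: yoneda_ext; rewrite /= /yoel_app !fmap1.
exists (linear_fun yl), (fun f => (f : Nat (yo X) (yo A)) X (idm X)) => [x|f].
  exact: yoel_id.
by apply: yoneda_ext; exact: yoel_id.
Qed.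
End ProjectiveValues.

(** * Dualities between categories of finitely presented functors *)

(** Only the formal properties of the duality are kept, so that its inverse is
    an object of the same kind and every argument can be read in both
    directions. *)
Record duality (R : comPzRingType) (C C' : linCat R) := Duality {
  dob :> fpMod C -> fpMod C';
  dmap : forall M N : fpMod C, Nat M N -> Nat (dob N) (dob M);
  dmap_inj : forall M N : fpMod C, injective (@dmap M N);
  dmap_surj : forall (M N : fpMod C) (g : Nat (dob N) (dob M)),
    exists f, dmap f = g;
  dmapD : forall (M N : fpMod C) (f g : Nat M N),
    dmap (f + g) = dmap f + dmap g;
  dmap1 : forall M : fpMod C, dmap (nat_id M) = nat_id (dob M);
  dmapM : forall (L M N : fpMod C) (g : Nat M N) (f : Nat L M),
    dmap (g \oN f) = dmap f \oN dmap g;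
  dob_surj : forall N : fpMod C', exists M : fpMod C, nat_iso (dob M) N
}.

Section Isomorphisms.
Variables (R : comPzRingType) (C : linCat R).

Lemma nat_compK (M N : Mod C) (f : Nat M N) (g : Nat N M) :
  g \oN f = nat_id M -> forall X, cancel (f X) (g X).
Proof. by move=> gf X x; exact: (nat_congr gf x). Qed.

Lemma nat_iso_sym (M N : Mod C) : nat_iso M N -> nat_iso N M.
Proof. by move=> [f [g [gf fg]]]; exists g, f. Qed.

Lemma nat_iso_addc (M N : Mod C) : nat_iso M N -> addc M N.
Proof. by move=> [f [g [_ fg]]]; exact: retract_addc fg. Qed.

Lemma nat_injP (M N : Mod C) (f : Nat M N) :
  (forall X x, f X x = 0 -> x = 0) -> nat_inj f.
Proof.
move=> f0 X x y e; apply/eqP; rewrite -subr_eq0; apply/eqP/f0.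
by rewrite raddfB e subrr.
Qed.

Lemma nat_inj_eq0 (M N : Mod C) (f : Nat M N) X (x : M X) :
  nat_inj f -> f X x = 0 -> x = 0.
Proof. by move=> fi fx; apply: (fi X); rewrite raddf0. Qed.

Lemma PP_iso (P : Mod C) k (X Y : fpMod C) :
  nat_iso X Y -> PP P k X -> PP P k Y.
Proof.
move=> [f [g [gf fg]]] [Q [e [d [Qp es d0e dd Qadd]]]].
have fI : nat_inj f by move=> Z; apply: (can_inj (g := g Z)); exact: nat_compK.
exists Q, (f \oN e), d; split=> // [Z y | Z y].
  have [x ex] := es Z (g Z y); exists x; rewrite /= ex; exact: (nat_compK fg).
rewrite -d0e; split=> /= [fey|->]; last by rewrite raddf0.
exact: nat_inj_eq0 fI fey.
Qed.

Lemma II_iso (J : Mod C) k (X Y : fpMod C) :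
  nat_iso X Y -> II J k X -> II J k Y.
Proof.
move=> [f [g [gf fg]]] [Q [e [d [Qi ei ed0 dd Qadd]]]].
have gI : nat_inj g by move=> Z; apply: (can_inj (g := f Z)); exact: nat_compK.
exists Q, (e \oN g), d; split=> // [Z x y /ei /gI //| Z y].
rewrite ed0; split=> [[x <-]|[x <-]]; last by exists (g Z x).
by exists (f Z x); rewrite /= (nat_compK gf).
Qed.

Lemma PP_addc (P P' : Mod C) k (X : fpMod C) :
  addc P' P -> PP P k X -> PP P' k X.
Proof.
move=> PP' [Q [e [d [? ? ? ? Qadd]]]]; exists Q, e, d; split=> // i /Qadd.
by move=> /in_addE Qi; apply/in_addE/(addc_trans PP').
Qed.

Lemma II_addc (J J' : Mod C) k (X : fpMod C) :
  addc J' J -> II J k X -> II J' k X.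
Proof.
move=> JJ' [Q [e [d [? ? ? ? Qadd]]]]; exists Q, e, d; split=> // i /Qadd.
by move=> /in_addE Qi; apply/in_addE/(addc_trans JJ').
Qed.

End Isomorphisms.

Section Duality.
Variables (R : comPzRingType) (C C' : linCat R) (D : duality C C').
Hypotheses (addC : additive_category C) (addC' : additive_category C').

Lemma dmap0 (M N : fpMod C) : dmap D (0 : Nat M N) = 0.
Proof. by apply: (addrI (dmap D (0 : Nat M N))); rewrite -dmapD !addr0. Qed.

Lemma dmap_eq0 (M N : fpMod C) (f : Nat M N) : dmap D f = 0 -> f = 0.
Proof. by move=> f0; apply: (dmap_inj (d := D)); rewrite dmap0. Qed.

Lemma dmap_sum (M N : fpMod C) n (f : 'I_n -> Nat M N) :
  dmap D (\sum_i f i) = \sum_i dmap D (f i).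
Proof. by apply: big_morph => [f' g|]; [exact: dmapD | exact: dmap0]. Qed.

Lemma dmap_addc (M X : fpMod C) : addc M X -> addc (D M) (D X).
Proof.
move=> [n [a [b e]]]; exists n, (fun i => dmap D (b i)), (fun i => dmap D (a i)).
rewrite -dmap1 -e dmap_sum; apply: eq_bigr => i _; exact/esym/dmapM.
Qed.

Lemma dmap_reflect_iso (M N : fpMod C) : nat_iso (D M) (D N) -> nat_iso M N.
Proof.
move=> [f [g [gf fg]]].
have [f' ef] := dmap_surj f; have [g' eg] := dmap_surj g.
by exists g', f'; split; apply: (dmap_inj (d := D));
  rewrite dmapM ef eg dmap1.
Qed.

(** Yoneda's lemma read through the duality: [D M X] is [Hom(M, I)], and [c] is
    its universal element. *)
Lemma corepresentable (X : C') (I : fpMod C) : nat_iso (D I) (yo X) ->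
  exists c : D I X,
  (forall (M : fpMod C) (v : D M X), exists w : Nat M I, dmap D w X c = v) /\
  (forall (M : fpMod C) (w : Nat M I), dmap D w X c = 0 -> w = 0).
Proof.
move=> [al [be [beal albe]]].
exists (be X (idm X)); split=> [M v|M w wc0].
  have [w we] := dmap_surj (yoel v \oN al).
  exists w; rewrite we /= -[RHS]yoel_id; congr (yoel v X _).
  exact: (nat_compK albe).
apply: dmap_eq0; rewrite -[LHS]nat_comp1r -beal nat_compA.
suff -> : dmap D w \oN be = 0 by rewrite nat_comp0l.
exact: (@yoneda_ext _ _ X).
Qed.

Lemma dmap_surj_inj (M N : fpMod C) (f : Nat M N) :
  nat_surj (dmap D f) -> nat_inj f.
Proof.
move=> Dfs; apply: nat_injP => X x fx0.
have : (yoel x : Nat (yofp addC X) M) = 0.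
  apply/dmap_eq0/(surj_cancel Dfs); rewrite nat_comp0l -dmapM comp_yoel fx0.
  by rewrite -(dmap0 _ N); congr dmap; apply: yoneda_ext; exact: yoel_id.
by move=> /nat_congr /(_ X (idm X)); rewrite yoel_id.
Qed.

(** Pointwise injectivity and surjectivity are categorical notions in mod C, by
    the Yoneda lemma and by the existence of cokernels respectively; so a
    duality exchanges them. *)
Lemma dmap_inj_surj (M N : fpMod C) (f : Nat M N) :
  nat_inj f -> nat_surj (dmap D f).
Proof.
move=> fi; apply: (eq0_cancel_surj addC') => K g gDf.
have [L [al [be [beal albe]]]] := dob_surj D K.
have [h eh] := dmap_surj (be \oN g).
have h0 : h = 0.
  apply: Nat_ext => X x; apply: (nat_inj_eq0 fi) => /=.
  have : f \oN h = 0.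
    by apply: dmap_eq0; rewrite dmapM eh -nat_compA gDf nat_comp0r.
  by move=> /nat_congr /(_ X x).
by rewrite -[g]nat_comp1l -albe -nat_compA -eh h0 dmap0 nat_comp0r.
Qed.

Lemma dmap_inj_reflect_surj (M N : fpMod C) (f : Nat M N) :
  nat_inj (dmap D f) -> nat_surj f.
Proof.
move=> Dfi; apply: (eq0_cancel_surj addC) => K g gf.
apply: dmap_eq0; apply: Nat_ext => X x; apply: (nat_inj_eq0 Dfi).
have : dmap D f \oN dmap D g = 0 by rewrite -dmapM gf dmap0.
by move=> /nat_congr /(_ X x).
Qed.

Lemma dmap_surj_dual (M N : fpMod C) (f : Nat M N) :
  nat_surj f -> nat_inj (dmap D f).
Proof.
move=> fs; apply: nat_injP => X v.
have [I iI] := dob_surj D (yofp addC' X).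
have [c [cex cuniq]] := corepresentable iI.
have [w <-] := cex N v => e.
suff -> : w = 0 by rewrite dmap0.
apply: (surj_cancel fs); rewrite nat_comp0l; apply: cuniq.
by rewrite dmapM.
Qed.

Lemma injective_dual_projective (I : fpMod C) :
  injective_obj I -> projective (D I).
Proof.
move=> Ii M' N' g u gs.
have [M [aM [bM [baM abM]]]] := dob_surj D M'.
have [N [aN [bN [baN abN]]]] := dob_surj D N'.
have [f fE] := dmap_surj (bN \oN g \oN aM).
have fi : nat_inj f.
  apply: dmap_surj_inj => X y; have [m em] := gs X (aN X y).
  exists (bM X m); rewrite fE /= (nat_compK abM) em; exact: (nat_compK baN).
have [v vE] := dmap_surj (bN \oN u).
have [w wE] := Ii _ _ f v fi.
have gaM : g \oN aM = aN \oN dmap D f by rewrite fE !nat_compA abN nat_comp1l.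
exists (aM \oN dmap D w).
by rewrite nat_compA gaM -nat_compA -dmapM wE vE nat_compA abN nat_comp1l.
Qed.

Lemma projective_dual_injective (Q : fpMod C) :
  projective Q -> injective_obj (D Q).
Proof.
move=> Qp M' N' g u gi.
have [M [aM [bM [baM abM]]]] := dob_surj D M'.
have [N [aN [bN [baN abN]]]] := dob_surj D N'.
have [f fE] := dmap_surj (bN \oN g \oN aM).
have fs : nat_surj f.
  apply: dmap_inj_reflect_surj; apply: nat_injP => X x.
  rewrite fE /= => e.
  have e1 : g X (aM X x) = 0.
    by rewrite -[LHS](nat_compK abN) e raddf0.
  by rewrite -[x](nat_compK baM) (nat_inj_eq0 gi e1) raddf0.
have [v vE] := dmap_surj (u \oN aM).
have [w wE] := Qp _ _ f v fs.
have bNg : bN \oN g = dmap D f \oN bM by rewrite fE -nat_compA abM nat_comp1r.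
exists (dmap D w \oN bN).
by rewrite -nat_compA bNg nat_compA -dmapM wE vE -nat_compA abM nat_comp1r.
Qed.

(** An element of [D M X] killed by [D f] is a map from [M] to some [I] which
    vanishes on the image of [f]. It factors through the cokernel of [f], which
    embeds in [N] by exactness, and [D] makes this embedding surjective. *)
Lemma dmap_exact (L M N : fpMod C) (f : Nat L M) (g : Nat M N) :
  nat_exact f g -> nat_exact (dmap D g) (dmap D f).
Proof.
move=> fg X v; split=> [|[x <-]]; last first.
  have gf0 : g \oN f = 0 by apply: nat_eq0P => Y y /=; apply/fg; exists y.
  have : dmap D f \oN dmap D g = 0 by rewrite -dmapM gf0 dmap0.
  by move=> /nat_congr /(_ X x).
have [I iI] := dob_surj D (yofp addC' X).
have [c [cex cuniq]] := corepresentable iI.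
have [w <-] := cex M v => e.
have wf0 : w \oN f = 0 by apply: cuniq; rewrite dmapM.
(* The cokernel [K] of [f] embeds in [N]. *)
have [K [q [qs fq]]] := coker_fp addC f.
have [w' w'E] := coker_exact_factor qs fq wf0.
have [g' g'E] : exists g' : Nat K N, g' \oN q = g.
  by apply: surj_factor => // Y y /fq [z <-]; apply/fg; exists z.
have g'i : nat_inj g'.
  apply: nat_injP => Y k; have [y <-] := qs Y k => e'.
  have : g Y y = 0 by rewrite -g'E.
  by move=> /fg [z <-]; apply/fq; exists z.
have [z ez] := dmap_inj_surj g'i (dmap D w' X c).
by exists z; rewrite -g'E dmapM /= ez -w'E dmapM.
Qed.

Lemma II_dual (J : fpMod C) k (X : fpMod C) : II J k X -> PP (D J) k (D X).
Proof.
move=> [Q [e [d [Qi ei ed0 dd Qadd]]]].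
exists (fun i => D (Q i)), (dmap D e), (fun i => dmap D (d i)); split.
- by move=> i; apply/injective_dual_projective/Qi.
- exact: dmap_inj_surj.
- exact: dmap_exact.
- by move=> i; exact: dmap_exact.
by move=> i /Qadd /in_addE JQ; apply/in_addE/dmap_addc.
Qed.

Lemma PP_dual (P : fpMod C) k (X : fpMod C) : PP P k X -> II (D P) k (D X).
Proof.
move=> [Q [e [d [Qp es d0e dd Qadd]]]].
exists (fun i => D (Q i)), (dmap D e), (fun i => dmap D (d i)); split.
- by move=> i; apply/projective_dual_injective/Qp.
- exact: dmap_surj_dual.
- exact: dmap_exact.
- by move=> i; exact: dmap_exact.
by move=> i /Qadd /in_addE PQ; apply/in_addE/dmap_addc.
Qed.

(** The dual of the cokernel of [D f] is a kernel of [f] in the category mod C.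
    It is also the pointwise kernel, since elements are maps from
    representable functors, which lie in mod C. *)
Lemma duality_fg_kernels : fg_kernels C.
Proof.
move=> M N f.
have [K' [q [qs fq]]] := coker_fp addC' (dmap D f).
have [K [al [be [beal albe]]]] := dob_surj D K'.
have [g gE] := dmap_surj (be \oN q).
have gs : nat_surj (dmap D g).
  move=> X x; have [y ey] := qs X (al X x); exists y.
  by rewrite gE /= ey (nat_compK beal).
have fg0 : f \oN g = 0.
  apply: dmap_eq0; rewrite dmapM gE -nat_compA.
  apply: nat_eq0P => X x /=; suff -> : q X (dmap D f X x) = 0 by rewrite raddf0.
  by apply/fq; exists x.
have [Z [e es]] := fp_fin_gen (fpmodP K).
exists Z, (g \oN e) => X x; split=> [fx0|[z <-]]; last exact: (nat_congr fg0).
pose x' : Nat (yofp addC X) M := yoel x.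
have fx' : f \oN x' = 0.
  by rewrite comp_yoel fx0; apply: yoneda_ext; exact: yoel_id.
have : dmap D x' \oN dmap D f = 0 by rewrite -dmapM fx' dmap0.
move=> /(coker_exact_factor qs fq) [u uE].
have [y yE] := dmap_surj (u \oN al).
have x'E : x' = g \oN y.
  apply: (dmap_inj (d := D)); rewrite dmapM gE yE -nat_compA [al \oN _]nat_compA.
  by rewrite albe nat_comp1l.
have [z ez] := es X (y X (idm X)).
exists z; rewrite /= ez -[RHS](yoel_id x); exact/esym/(nat_congr x'E).
Qed.

Lemma reverse_duality :
  exists D' : duality C' C, forall N : fpMod C', nat_iso (D (D' N)) N.
Proof.
pose ob (N : fpMod C') := sval (cid (dob_surj D N)).
have iso (N : fpMod C') : nat_iso (D (ob N)) N by rewrite /ob; case: cid.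
pose al (N : fpMod C') : Nat (D (ob N)) N := sval (cid (iso N)).
pose be (N : fpMod C') : Nat N (D (ob N)) := sval (cid (svalP (cid (iso N)))).
have [beal albe] : (forall N, be N \oN al N = nat_id _) /\
    (forall N, al N \oN be N = nat_id N).
  by split=> N; rewrite /be /al; case: (svalP (cid (svalP (cid (iso N))))).
have m_ex (M N : fpMod C') (f : Nat M N) :
    exists g : Nat (ob N) (ob M), dmap D g = be N \oN f \oN al M.
  exact: dmap_surj.
pose m (M N : fpMod C') f := sval (cid (@m_ex M N f)).
have mE M N f : dmap D (@m M N f) = be N \oN f \oN al M by rewrite /m; case: cid.
unshelve eexists (@Duality R C' C ob m _ _ _ _ _ _); last exact: iso.
- move=> M N f g e; have := congr1 (@dmap _ _ _ D _ _) e; rewrite !mE => e'.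
  have := congr1 (fun h => al N \oN h \oN be M) e'.
  by rewrite !nat_compA !albe !nat_comp1l -!nat_compA albe !nat_comp1r.
- move=> M N g; exists (al N \oN dmap D g \oN be M).
  apply: (dmap_inj (d := D)); rewrite mE !nat_compA beal nat_comp1l.
  by rewrite -nat_compA beal nat_comp1r.
- move=> M N f g; apply: (dmap_inj (d := D)); rewrite dmapD !mE.
  by apply: Nat_ext => X x; rewrite /= raddfD.
- move=> M; apply: (dmap_inj (d := D)).
  by rewrite mE dmap1 nat_comp1r beal.
- move=> L M N g f; apply: (dmap_inj (d := D)); rewrite dmapM !mE.
  by rewrite -!nat_compA [al M \oN _]nat_compA albe nat_comp1l.
move=> M; exists (D M); apply: dmap_reflect_iso; exact: iso.
Qed.

End Duality.

(** One side speaks of all functors in mod C and the other of all functors in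
    the dual category, so the transport uses both [D] and its inverse. *)
Lemma duality_II_iff_PP (R : comPzRingType) (C C' : linCat R)
    (D : duality C C') (D' : duality C' C) (P : fpMod C') (J : fpMod C) :
  additive_category C -> additive_category C' ->
  (forall N : fpMod C', nat_iso (D (D' N)) N) ->
  addc (D' P) J -> addc J (D' P) ->
  (forall X : fpMod C, II J (Some 1%N) X <-> II J None X) <->
  (forall Y : fpMod C', PP P (Some 1%N) Y <-> PP P None Y).
Proof.
move=> addC addC' DD' addJ addJ'.
have D'D (M : fpMod C) : nat_iso (D' (D M)) M.
  exact/(dmap_reflect_iso (D := D))/DD'.
have toPP k (X : fpMod C) : II J k X -> PP P k (D X).
  move=> /(II_dual D addC addC'); apply: PP_addc.
  apply: addc_trans (nat_iso_addc (nat_iso_sym (DD' P))) _.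
  exact: (dmap_addc D addJ).
have toII k (Y : fpMod C') : PP P k Y -> II J k (D' Y).
  by move=> /(PP_dual D' addC' addC); exact: II_addc.
split=> h X; split.
- by move=> /toII/h/toPP; exact: PP_iso.
- by move=> /toII/h/toPP; exact: PP_iso.
- by move=> /toPP/h/toII; exact: II_iso.
- by move=> /toPP/h/toII; exact: II_iso.
Qed.

(** * Minimal submodules over an artinian ring *)

Section DescendingChains.
Variables (R : comPzRingType) (U : lmodType R).

Definition submodule (N : set U) : Prop :=
  N 0 /\ forall a x y, N x -> N y -> N (a *: x + y).

Lemma submoduleB (N : set U) x y : submodule N -> N x -> N y -> N (x - y).
Proof. by move=> [_ NP] Nx Ny; rewrite addrC -scaleN1r; exact: NP. Qed.

Lemma submoduleD (N : set U) x y : submodule N -> N x -> N y -> N (x + y).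
Proof. by move=> [_ NP] Nx Ny; rewrite -[x]scale1r; exact: NP. Qed.

(** Induction on the number of generators: the possible coefficients of the
    first generator in [S k] form a descending chain of ideals, and once these
    are stable only combinations of the other generators matter. *)
Lemma chain_stable_on_span (artR : artinian R) n (v : 'I_n -> U)
    (S : nat -> set U) :
  (forall k, submodule (S k)) ->
  (forall k l, (k <= l)%N -> forall x, S l x -> S k x) ->
  exists N, forall k, (N <= k)%N -> forall a : 'I_n -> R,
    S N (\sum_i a i *: v i) -> S k (\sum_i a i *: v i).
Proof.
move=> Ssub Sdec; elim: n v => [|n IHn] v.
  by exists 0%N => k _ a _; rewrite big_ord0; have [] := Ssub k.
pose v' i := v (lift ord0 i).
pose I k (r : R) := exists a : 'I_n -> R,
  S k (r *: v ord0 + \sum_i a i *: v' i).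
have Iideal k : ideal (I k).
  split=> [|r s [a Sa] [b Sb]|s r [a Sa]].
  - exists (fun=> 0); rewrite scale0r big1 ?addr0 => [|i _]; last exact: scale0r.
    by have [] := Ssub k.
  - exists (fun i => a i + b i).
    have -> : \sum_i (a i + b i) *: v' i = \sum_i a i *: v' i + \sum_i b i *: v' i.
      by rewrite -big_split; apply: eq_bigr => i _; rewrite scalerDl.
    by rewrite scalerDl addrACA; apply: submoduleD.
  exists (fun i => s * a i).
  have -> : \sum_i (s * a i) *: v' i = s *: \sum_i a i *: v' i.
    by rewrite scaler_sumr; apply: eq_bigr => i _; rewrite scalerA.
  rewrite -scalerA -scalerDr -[_ *: _]addr0.
  by have [S0 SP] := Ssub k; exact: SP.
have [N1 N1P] : exists N, forall k, (N <= k)%N -> I k = I N.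
  by apply: artR => // k r [a Sa]; exists a; apply: Sdec Sa.
have [N2 N2P] := IHn v'.
exists (maxn N1 N2) => k; rewrite geq_max => /andP[N1k N2k] a.
rewrite big_ord_recl -/v' => Sx.
have Sx1 := Sdec _ _ (leq_maxl N1 N2) _ Sx.
have Sx2 := Sdec _ _ (leq_maxr N1 N2) _ Sx.
have : I N1 (a ord0) by exists (fun i => a (lift ord0 i)).
rewrite -(N1P _ N1k) => -[b Sb].
have xy : a ord0 *: v ord0 + \sum_i a (lift ord0 i) *: v' i -
    (a ord0 *: v ord0 + \sum_i b i *: v' i) =
    \sum_i (a (lift ord0 i) - b i) *: v' i.
  rewrite opprD addrACA subrr add0r -sumrB.
  by apply: eq_bigr => i _; rewrite scalerBl.
rewrite -[X in S k X](subrK (a ord0 *: v ord0 + \sum_i b i *: v' i)).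
apply: submoduleD => //; rewrite xy; apply: N2P => //; rewrite -xy.
by apply: submoduleB => //; exact: Sdec N2k _ Sb.
Qed.

Lemma minimal_submodule (artR : artinian R) (F : set U -> Prop) (N0 : set U) :
  finitely_generated U -> (forall N, F N -> submodule N) -> F N0 ->
  exists N, F N /\ forall N', F N' -> (forall x, N' x -> N x) ->
    forall x, N x -> N' x.
Proof.
move=> [n [v vgen]] Fsub FN0; apply: contrapT => nomin.
have step (s : {N | F N}) : exists s' : {N | F N},
    (forall x, sval s' x -> sval s x) /\ exists x, sval s x /\ ~ sval s' x.
  case: s => N FN /=; apply: contrapT => h; apply: nomin; exists N; split=> //.
  move=> N' FN' N'N x Nx; apply: contrapT => nN'x; apply: h.
  by exists (exist _ N' FN'); split=> //; exists x.
pose next s := sval (cid (step s)).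
pose S k := sval (iter k next (exist _ N0 FN0)).
have SS k : (forall x, S k.+1 x -> S k x) /\ exists x, S k x /\ ~ S k.+1 x.
  rewrite /S /= /next; case: (cid (step _)) => s' [? ?]; by split.
have Sdec k l : (k <= l)%N -> forall x, S l x -> S k x.
  elim: l => [|l IHl]; first by rewrite leqn0 => /eqP ->.
  rewrite leq_eqVlt => /predU1P[-> //|/IHl h x /(SS l).1]; exact: h.
have Ssub k : submodule (S k) by apply: Fsub; exact: svalP.
have [N NP] := chain_stable_on_span artR v Ssub Sdec.
have [x [Nx]] := (SS N).2; apply; have [a xa] := vgen x.
by rewrite xa; apply: NP => //; rewrite -xa.
Qed.

End DescendingChains.

(** * Left ideals of End(A) and the radical of hom(A, -) *)

Section LeftIdeals.
Variables (R : comPzRingType) (C : linCat R) (A : C).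

Definition left_ideal (L : set (hom A A)) : Prop :=
  [/\ L 0, forall x y, L x -> L y -> L (x - y) &
      forall g x : hom A A, L x -> L (g \oC x)].

Definition maximal_left_ideal (m : set (hom A A)) : Prop :=
  [/\ left_ideal m, ~ m (idm A) &
      forall L, left_ideal L -> (exists x, L x /\ ~ m x) ->
        (forall x, m x -> L x) -> L (idm A)].

Lemma left_idealD (L : set (hom A A)) x y :
  left_ideal L -> L x -> L y -> L (x + y).
Proof.
move=> [L0 LB _] Lx Ly; rewrite -[y]opprK -[- y]sub0r.
exact: LB _ _ Lx (LB _ _ L0 Ly).
Qed.

Lemma left_ideal_submodule (L : set (hom A A)) : left_ideal L -> submodule L.
Proof.
move=> LL; have [L0 LB LM] := LL; split=> // a x y Lx Ly.
by apply: left_idealD => //; rewrite -[x]comp1m -compZl; exact: LM.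
Qed.

(** Used with [K] a maximal left ideal, to split the identity, and with [K] the
    annihilator of an element, to find a simple module. *)
Lemma minimal_left_ideal (artR : artinian R) (K : set (hom A A)) :
  finitely_generated (hom A A) -> ~ K (idm A) ->
  exists L, [/\ left_ideal L, exists x, L x /\ ~ K x &
    forall L', left_ideal L' -> (exists x, L' x /\ ~ K x) ->
      (forall x, L' x -> L x) -> forall x, L x -> L' x].
Proof.
move=> fg K1.
have [||L [[LL LK] Lmin]] := @minimal_submodule _ (hom A A) artR
    (fun L => left_ideal L /\ exists x, L x /\ ~ K x) (fun=> True) fg.
- by move=> N [/left_ideal_submodule].
- by split=> //; exists (idm A).
by exists L; split=> // L' LL' L'K; apply: Lmin.
Qed.

Lemma subfunctor_left_ideal (S : forall X, set (yo A X)) :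
  subfunctor S -> left_ideal (S A).
Proof.
move=> [S0 SB SM]; split=> [|x y|g x Sx]; [exact: S0|exact: SB|].
exact: (SM A A g x Sx).
Qed.

(** By maximality [S] and [y] together generate the whole functor, hence its
    element [idm A]. *)
Lemma maximal_subfunctor_split (S : forall X, set (yo A X)) X (y : hom A X) :
  maximal_subfunctor S -> ~ S X y ->
  exists (s : hom A A) (g : hom X A), S A s /\ idm A = s + g \oC y.
Proof.
move=> [[S0 SB SM] _ Smax] Sy.
pose S' Y (z : yo A Y) : Prop :=
  exists s (g : hom X Y), S Y s /\ z = s + (g \oC y : hom A Y).
have subS' : subfunctor S'.
  split=> [Y|Y _ _ [s [g [Ss ->]]] [t [h [St ->]]]|Y Z f _ [s [g [Ss ->]]]].
  - by exists 0, 0; split=> //; rewrite comp0l addr0.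
  - exists (s - t), (g - h); split; first exact: SB.
    by rewrite compDl compNl opprD addrACA.
  exists (f \oC (s : hom A Y)), (f \oC g); split; first exact: (SM Y Z f s Ss).
  by rewrite /= /post compDr compA.
have [|S'S|S'T] := Smax S' subS'.
- by move=> Y z Sz; exists z, 0; split=> //; rewrite comp0l addr0.
- case: Sy; rewrite -S'S; exists 0, (idm X); split; first exact: S0.
  by rewrite comp1m add0r.
have : S' A (idm A) by rewrite S'T.
by move=> [s [g [Ss e]]]; exists s, g.
Qed.

Lemma maximal_subfunctor_id (S : forall X, set (yo A X)) :
  maximal_subfunctor S -> ~ S A (idm A).
Proof.
move=> [[S0 SB SM] [X SX] _] S1; move/eqP: SX; apply; apply/seteqP.
split=> // x _.
by have := SM _ _ (x : hom A X) _ S1; rewrite /= /post compm1.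
Qed.

(** The largest subfunctor with value [m] at [A]. It links the radical, which
    is defined by subfunctors, with the ring [End(A)]. *)
Lemma maximal_left_ideal_subfunctor (m : set (hom A A)) :
  maximal_left_ideal m ->
  maximal_subfunctor (fun X (x : yo A X) => forall g : hom X A, m (g \oC x)).
Proof.
move=> [Lm m1 mmax]; have [m0 mB mM] := Lm.
split; first split.
- by move=> X g; rewrite comp0r.
- by move=> X x y mx my g; rewrite compDr compNr; exact: mB.
- by move=> X Y f x mx g; rewrite /= /post compA; exact: mx.
- exists A; apply/eqP => e; apply: m1.
  have : @setT (yo A A) (idm A) by [].
  by rewrite -e => /(_ (idm A)); rewrite comp1m.
move=> S' subS' mS'; have LS' := subfunctor_left_ideal subS'.
have [S'0 S'B S'M] := subS'.
have [[X [x [S'x nx]]]|none] := pselect (exists X (x : yo A X), S' X x /\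
    ~ forall g : hom X A, m (g \oC x)).
  right=> Y; apply/seteqP; split=> // y _.
  suff S'1 : S' A (idm A).
    by have := S'M _ _ (y : hom A Y) _ S'1; rewrite /= /post compm1.
  have [g ng] : exists g : hom X A, ~ m (g \oC x) by exact/existsNP.
  apply: mmax => //; first by exists (g \oC x); split=> //; exact: (S'M _ _ g x).
  by move=> z mz; apply: mS' => g'; exact: mM.
left=> X; apply/seteqP; split=> x; last exact: mS'.
by move=> S'x; apply: contrapT => nx; apply: none; exists X, x.
Qed.

(** If [x] is outside a maximal subfunctor [S], the splitting of the identity
    gives a multiple [g x] outside [S] as well. *)
Lemma radical_detect X (x : hom A X) :
  (forall g : hom X A, @radical _ _ (yo A) A (g \oC x)) ->
  @radical _ _ (yo A) X x.
Proof.
move=> rx S Smax; apply: contrapT => nx.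
have [s [g [Ss e]]] := maximal_subfunctor_split Smax nx.
apply: (maximal_subfunctor_id Smax); rewrite e.
have [subS _ _] := Smax.
apply: (left_idealD (subfunctor_left_ideal subS)) => //; exact: rx.
Qed.

(** Every simple left [End(A)]-module embeds into [End(A)] modulo its radical:
    the class of [tau] has annihilator [m]. Modulo the radical, a left ideal [N]
    minimal among those not inside [m] is a complement of [m], and [tau] is the
    component of the identity in [N]. *)
Lemma simple_in_top (artR : artinian R) (m : set (hom A A)) :
  finitely_generated (hom A A) -> maximal_left_ideal m ->
  exists tau : hom A A, forall la : hom A A,
    @radical _ _ (yo A) A (la \oC tau) <-> m la.
Proof.
move=> fg mmax; have [Lm m1 mP] := mmax; have [m0 mB mM] := Lm.
have [N [LN [x0 [Nx0 mx0]] Nmin]] := minimal_left_ideal artR fg m1.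
have [N0 NB NM] := LN.
have Nm_rad y : N y -> m y -> @radical _ _ (yo A) A y.
  move=> Ny my S Smax; apply: contrapT => Sy.
  have [s [g [Ss e]]] := maximal_subfunctor_split Smax Sy.
  have [subS _ _] := Smax.
  have LS := subfunctor_left_ideal subS; have [S0 SB SM] := LS.
  pose L' x := N x /\ S A x.
  have LL' : left_ideal L'.
    split=> [|u v [Nu Su] [Nv Sv]|h u [Nu Su]]; first by split.
      by split; [exact: NB | exact: SB].
    by split; [exact: NM | exact: SM].
  have [[x L'x]|none] := pselect (exists x, L' x /\ ~ m x).
    by have [] := Nmin L' LL' (ex_intro _ x L'x) (fun u => @proj1 _ _) y Ny.
  apply: mx0; rewrite -[x0]compm1 e compDr; apply: left_idealD => //.
    apply: contrapT => nm; apply: none; exists (x0 \oC s); split=> //.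
    split; last exact: SM.
    suff -> : x0 \oC s = x0 - x0 \oC g \oC y by apply: NB => //; exact: NM.
    by rewrite -{2}[x0]compm1 e compDr compA addrK.
  by rewrite compA; exact: mM.
have [tau [mu [Ntau mmu e]]] :
    exists tau mu, [/\ N tau, m mu & idm A = tau + mu].
  pose L z := exists tau mu, [/\ N tau, m mu & z = tau + mu].
  apply: (mP L); last by move=> z mz; exists 0, z; split=> //; rewrite add0r.
    split=> [|_ _ [t [u [Nt mu ->]]] [t' [u' [Nt' mu' ->]]]|g _ [t [u [Nt mu ->]]]].
    - by exists 0, 0; split=> //; rewrite addr0.
    - exists (t - t'), (u - u'); split; [exact: NB|exact: mB|].
      by rewrite opprD addrACA.
    by exists (g \oC t), (g \oC u); split; [exact: NM|exact: mM|rewrite compDr].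
  by exists x0; split=> //; exists x0, 0; split=> //; rewrite addr0.
have lamu (la : hom A A) : la = la \oC tau + la \oC mu by rewrite -compDr -e compm1.
exists tau => la; split=> [rad|mla].
  rewrite (lamu la); apply: left_idealD => //; last exact: mM.
  have := rad _ (maximal_left_ideal_subfunctor mmax) => /(_ (idm A)).
  by rewrite comp1m.
apply: Nm_rad; first exact: NM.
have -> : la \oC tau = la - la \oC mu by rewrite {2}(lamu la) addrK.
by apply: mB => //; exact: mM.
Qed.

(** The multiple [l k] generates a simple module when [l] lies in a left ideal
    minimal among those that do not annihilate [k]. *)
Lemma simple_submodule (artR : artinian R) (M : Mod C) (k : M A) :
  finitely_generated (hom A A) -> k <> 0 ->
  exists l : hom A A, maximal_left_ideal
    (fun la : hom A A => fmap M la (fmap M l k) = 0).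
Proof.
move=> fg k0; pose ann (la : hom A A) := fmap M la k = 0.
have ann1 : ~ ann (idm A) by rewrite /ann fmap1.
have [L [LL [l [Ll nl]] Lmin]] := minimal_left_ideal artR fg ann1.
have [L0 LB LM] := LL.
have annL (k' : M A) : left_ideal (fun la : hom A A => fmap M la k' = 0).
  split=> [|x y xk yk|g x xk]; first exact: fmap0.
    by rewrite fmapD fmapN xk yk subr0.
  by rewrite fmapM xk raddf0.
exists l; split=> //; first by rewrite fmap1.
move=> K LK [x [Kx nx]] annK; have [K0 KB KM] := LK.
have [mu muE] : exists mu : hom A A, l = mu \oC (x \oC l).
  apply: (Lmin (fun z => exists mu : hom A A, z = mu \oC (x \oC l))) => //.
  - split=> [|_ _ [u ->] [v ->]|g _ [u ->]].
    + by exists 0; rewrite comp0l.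
    + by exists (u - v); rewrite compDl compNl.
    by exists (g \oC u); rewrite compA.
  - exists (x \oC l); split; first by exists (idm A); rewrite comp1m.
    by rewrite /ann fmapM.
  by move=> _ [mu ->]; apply/LM/LM.
rewrite -[idm A](subrK (mu \oC x)); apply: left_idealD => //; last exact: KM.
apply: annK; rewrite -fmapM compDl compNl comp1m -compA -muE.
by rewrite subrr fmap0.
Qed.

End LeftIdeals.

(** * The injective envelope of the top of P *)

Section PowerFP.
Variables (R : comPzRingType) (C : linCat R).
Hypothesis addC : additive_category C.

Lemma power_fp (M : Mod C) n :
  finitely_presented M -> finitely_presented (power M n).
Proof.
move=> [C1 [C0 [d [e [de es]]]]].
have [S1 [i1 [p1 [pi1 ip1]]]] := biproduct addC C1 n.
have [S0 [i0 [p0 [pi0 ip0]]]] := biproduct addC C0 n.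
pose del : hom C0 C1 := d C1 (idm C1).
have dE Z (y : hom C1 Z) : d Z y = y \oC del := nat_yoE d y.
have d1i j : (\sum_i (i1 i \oC del \oC p0 i)) \oC i0 j = i1 j \oC del.
  rewrite comp_suml (bigD1 j) //= big1 => [|k ne].
    by rewrite -!compA pi0 eqxx compm1 addr0.
  by rewrite -!compA pi0 (negPf ne) !comp0r.
have cop0 Z (f : 'I_n -> hom C0 Z) j : (\sum_i (f i \oC p0 i)) \oC i0 j = f j.
  rewrite comp_suml (bigD1 j) //= big1 => [|k ne].
    by rewrite -!compA pi0 eqxx compm1 addr0.
  by rewrite -!compA pi0 (negPf ne) !comp0r.
exists S1, S0, (yoel (\sum_i (i1 i \oC del \oC p0 i) : yo S0 S1)),
  (pow_in (fun j => e \oN yoel (i0 j : yo C0 S0))); split; last first.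
  move=> Z v; have vex j := es Z (v j).
  pose z j : hom C0 Z := sval (cid (vex j)).
  exists (\sum_i (z i \oC p0 i)); apply/ffunP => j.
  rewrite ffunE /= /yoel_app /= /post cop0 /z; by case: cid.
move=> Z z; split=> [e0|[y <-]].
  have yex j : exists y : hom C1 Z, y \oC del = (z : hom S0 Z) \oC i0 j.
    have /de [y yE] : e Z ((z : hom S0 Z) \oC i0 j : yo C0 Z) = 0.
      by have /ffunP /(_ j) := e0; rewrite !ffunE.
    by exists y; rewrite -dE.
  pose y j := sval (cid (yex j)).
  exists (\sum_j (y j \oC p1 j)); rewrite /= /yoel_app /= /post.
  rewrite -[RHS]compm1 -ip0 !comp_sumr; apply: eq_bigr => j _.
  rewrite !compA comp_suml (bigD1 j) //= big1 => [|k ne].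
    rewrite -[_ \oC p1 j \oC _]compA pi1 eqxx compm1 addr0 /y.
    by case: cid => /= ? ->.
  by rewrite -[_ \oC p1 k \oC _]compA pi1 (negPf ne) comp0r.
apply/ffunP => j; rewrite !ffunE /= /yoel_app /= /post -compA d1i compA -dE.
by apply/de; eexists.
Qed.

Lemma fp_values_fg (M : fpMod C) (X : C) :
  (forall Y Z : C, finitely_generated (hom Y Z)) ->
  finitely_generated (RValue M X).
Proof.
move=> fg; have [B [e es]] := fp_fin_gen (fpmodP M).
have [n [v vgen]] := fg B X.
exists n, (fun i => e X (v i)) => x.
have [y <-] := es X x; have [a ->] := vgen y; exists a.
rewrite raddf_sum; apply: eq_bigr => i _.
rewrite -[RHS]/(fmap M (a i *: idm X) (e X (v i))) -natural /= /post.
by rewrite compZl comp1m.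
Qed.

End PowerFP.

Section DualDuality.
Variables (R : comPzRingType) (C : linCat R) (E : lmodType R).
Hypothesis dualC : dual_is_duality C E.

Lemma dual_fpP (M : fpMod C) : finitely_presented (dual E M).
Proof. by case: dualC. Qed.

(** Transparent, so that [D M X] computes to the module of functionals on
    [M X]. *)
Definition dual_duality : duality C (opcat C).
Proof.
refine (@Duality R C (opcat C) (fun M => MkFpMod (dual_fpP M))
  (fun M N f => dual_nat E f) _ _ _ _ _ _).
- by move=> M N; have [_ bij _] := dualC; exact: bij_inj (bij M N).
- by move=> M N g; have [_ bij _] := dualC; have [h _ hK] := bij M N; exists (h g).
- by move=> M N f g; apply: Nat_ext => X u; apply: linear_ext => x; exact: (raddfD u).
- by move=> M; apply: Nat_ext => X u; apply: linear_ext.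
- by move=> L M N g f; apply: Nat_ext => X u; apply: linear_ext.
by have [_ _ surj] := dualC.
Defined.

Hypotheses (addC : additive_category C)
  (fg : forall X Y : C, finitely_generated (hom X Y)).
Let D := dual_duality.
Let addC' := additive_op addC.
Variables (D' : duality (opcat C) C)
  (DD' : forall N : fpMod (opcat C), nat_iso (D (D' N)) N).

(** The injective functor [I S] represents the functionals at [S], that is
    [Hom(M, I S) = Hom_R(M(S), E)]. *)
Let I (S : C) : fpMod C := D' (yofp addC' (S : opcat C)).

Lemma I_universal (S : C) : exists c : Lin (RValue (I S) S) E,
  (forall (M : fpMod C) (u : Lin (RValue M S) E),
     exists w : Nat M (I S), forall x, c (w S x) = u x) /\
  (forall X (k : I S X), (forall g : hom X S, c (fmap (I S) g k) = 0) -> k = 0).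
Proof.
have [c [cex cuniq]] := corepresentable (DD' (yofp addC' (S : opcat C))).
exists c; split=> [M u|X k ck].
  have [w wE] := cex M u; exists w => x.
  by rewrite -wE.
have : (yoel k : Nat (yofp addC X) (I S)) = 0.
  by apply: cuniq; apply: linear_ext => g; exact: ck.
by move=> /nat_congr /(_ X (idm X)); rewrite yoel_id.
Qed.

Lemma I_injective (S : C) : injective_obj (I S).
Proof.
apply: (projective_dual_injective (D := D') addC').
exact/exproj_projective/exproj_yo.
Qed.

Lemma I_detect (S : C) X (k : I S X) :
  (forall g : hom X S, fmap (I S) g k = 0) -> k = 0.
Proof.
have [c [_ cdet]] := I_universal S => gk; apply: cdet => g.
by rewrite gk (raddf0 c).
Qed.

Lemma addc_I n (A S : C) (i : 'I_n -> hom A S) (p : 'I_n -> hom S A) :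
  \sum_j (i j \oC p j) = idm S -> addc (I A) (I S).
Proof.
move=> ip; apply: dmap_addc.
exact: (@addc_yo_biproduct _ (opcat C) A n S p i).
Qed.

(** The functionals with values in [E] separate the elements of a finitely
    presented functor, because the duality is faithful. *)
Lemma E_separates (M : fpMod C) X (t : M X) :
  (forall u : Lin (RValue M X) E, u t = 0) -> t = 0.
Proof.
move=> ut; have : (yoel t : Nat (yofp addC X) M) = 0.
  apply: (dmap_eq0 (D := D)); apply: nat_eq0P => Y u; apply: linear_ext => g.
  exact: (ut (u \o @rmap _ _ M X Y g : {linear RValue M X -> E})).
by move=> /nat_congr /(_ X (idm X)); rewrite yoel_id.
Qed.

(** The functionals form the value at [X] of the dual of [M], a finitely
    presented functor, so that finitely many of them generate all others over
    R. *)
Lemma finitely_many_functionals (M : fpMod C) X :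
  exists n (u : 'I_n -> Lin (RValue M X) E), forall t : M X,
    (forall i (la : hom X X), u i (fmap M la t) = 0) -> t = 0.
Proof.
have [n [u ugen]] := @fp_values_fg _ (opcat C) (D M) X (fun Y Z => fg Z Y).
exists n, u => t ut; apply: E_separates => v.
have [a ->] := ugen v.
have sumE (s : seq 'I_n) (F : 'I_n -> Lin (RValue M X) E) :
    (\sum_(i <- s) F i) t = \sum_(i <- s) F i t.
  by elim/big_rec2: _ => [//|i y1 y2 _ <-].
by rewrite sumE big1 // => i _; exact: ut.
Qed.

Section Envelope.
Variables (artR : artinian R) (A : C) (J T : fpMod C).
Variables (p : Nat (yo A) T) (i : Nat T J).
Hypotheses (ps : nat_surj p)
  (pker : forall X (x : yo A X), p X x = 0 <-> radical x)
  (envJ : injective_envelope i).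

(** The top has no nonzero subfunctor vanishing at [A]. *)
Lemma top_detect X (t : T X) : (forall g : hom X A, fmap T g t = 0) -> t = 0.
Proof.
have [x <-] := ps t => gx; apply/pker.
refine (@radical_detect _ _ A X x _) => g.
by apply/pker; rewrite -(gx g) -natural.
Qed.

(** The top [T] embeds in a finite sum of copies of [I A], hence so does its
    essential extension [J]. *)
Lemma envelope_addc : addc (I A) J.
Proof.
have [Jinj iinj iess] := envJ.
have [n [u uT]] := finitely_many_functionals T A.
have [S [inj [prj [pi ip]]]] := biproduct addC A n.
have [c [cex cdet]] := I_universal S.
pose uS := \sum_j @dual_map _ _ E T A S (prj j) (u j) : Lin (RValue T S) E.
have uSE (t : T S) : uS t = \sum_j u j (fmap T (prj j) t).
  rewrite /uS; elim/big_rec2: _ => [//|j y1 y2 _ <-] //.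
have [w wE] := cex T uS.
have winj : nat_inj w.
  apply: nat_injP => X t wt0; apply: top_detect => g; apply: uT => j la.
  have : uS (fmap T (inj j \oC (la \oC g)) t) = 0.
    by rewrite -wE natural wt0 !raddf0.
  rewrite uSE (bigD1 j) //= big1 => [|k ne]; last first.
    by rewrite -fmapM compA pi (negPf ne) comp0l fmap0 raddf0.
  by rewrite addr0 -fmapM compA pi eqxx comp1m fmapM.
have [w' w'E] := I_injective w iinj.
have w'inj : nat_inj w' by apply: iess; rewrite w'E.
have [r rE] := Jinj _ _ _ (nat_id J) w'inj.
exact: addc_trans (addc_I ip) (retract_addc rE).
Qed.

(** A nonzero element of [I A] has a multiple [k] generating a simple module,
    hence with the annihilator of an element of the top. The functors generated
    by both are then isomorphic, and the map to [J] extends to [I A]. *)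
Lemma cogenerated_by_envelope X (k0 : I A X) :
  k0 <> 0 -> exists f : Nat (I A) J, f X k0 <> 0.
Proof.
have [Jinj iinj _] := envJ => k0n.
have [g gk0] : exists g : hom X A, fmap (I A) g k0 <> 0.
  by apply/existsNP => h; apply: k0n; exact: I_detect.
have [l lmax] := simple_submodule artR (fg A A) gk0.
set k := fmap (I A) l _ in lmax.
have [tau tauE] := simple_in_top artR (fg A A) lmax.
pose t := p A tau.
have annE Y (x : hom A Y) : fmap (I A) x k = 0 <-> fmap T x t = 0.
  have eq (h : hom Y A) : fmap (I A) (h \oC x) k = 0 <-> fmap T (h \oC x) t = 0.
    by rewrite -(tauE (h \oC x)) -pker -natural.
  split=> e.
    by apply: top_detect => h; rewrite -fmapM; apply/eq; rewrite fmapM e raddf0.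
  by apply: I_detect => h; rewrite -fmapM; apply/eq; rewrite fmapM e raddf0.
have kers := duality_fg_kernels D addC addC'.
have [Z [z zk]] := kers (yofp addC A) (I A) (yoel k).
have [K [q [qs zq]]] := coker_fp addC (z : Nat (yofp addC Z) (yofp addC A)).
have [k' k'E] : exists k' : Nat K (I A), k' \oN q = yoel k.
  by apply: surj_factor => // Y x /zq /zk.
have [t' t'E] : exists t' : Nat K T, t' \oN q = yoel t.
  by apply: surj_factor => // Y x /zq /zk /annE.
have k'i : nat_inj k'.
  apply: nat_injP => Y y; have [x <-] := qs Y y => e.
  by apply/zq/zk; rewrite -k'E.
have [f fE] := Jinj _ _ k' (i \oN t') k'i.
exists f => fk0.
have [_ m1 _] := lmax; apply: m1; apply/annE.
have fk : f A k = 0 by rewrite /k !natural fk0 !raddf0.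
apply: (nat_inj_eq0 iinj).
have kq : k = k' A (q A (idm A)) by rewrite -[LHS]yoel_id -k'E.
have -> : fmap T (idm A) t = t' A (q A (idm A)).
  by rewrite -[RHS]/((t' \oN q) A (idm A)) t'E.
by have /= <- := nat_congr fE (q A (idm A)); rewrite -kq.
Qed.

(** A minimal joint kernel of finitely many maps to [J], taken in the artinian
    R-module of values at [A], is zero by [cogenerated_by_envelope]. Those maps
    are then jointly injective everywhere and embed [I A] in a power of [J]. *)
Lemma addc_envelope : addc J (I A).
Proof.
pose K n (f : 'I_n -> Nat (I A) J) (x : RValue (I A) A) : Prop :=
  forall j, f j A x = 0.
have Ksub n f : submodule (@K n f).
  split=> [|a x y Kx Ky] j; first by rewrite raddf0.
  by rewrite (nat_linear (f j)) Kx Ky scaler0 addr0.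
have [||_ [[n [f ->]] fmin]] := @minimal_submodule _ _ artR
    (fun N => exists n f, N = @K n f) (K 0%N (fun=> 0))
    (fp_values_fg (I A) A fg).
- by move=> _ [n [f ->]].
- by exists 0%N, (fun=> 0).
have f0 x : K n f x -> x = 0.
  move=> Kx; apply: contrapT => /cogenerated_by_envelope [h hx]; apply: hx.
  pose f' (j : 'I_n.+1) := if unlift ord0 j is Some k then f k else h.
  have : K _ f' x.
    apply: fmin Kx => [|y Ky j]; first by exists n.+1, f'.
    by have := Ky (lift ord0 j); rewrite /f' liftK.
  by move=> /(_ ord0); rewrite /f' unlift_none.
have finj : nat_inj (pow_in f).
  apply: nat_injP => X x e; apply: I_detect => g; apply: f0 => j.
  by have /ffunP /(_ j) := e; rewrite !ffunE natural => ->; rewrite raddf0.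
have [h hE] := I_injective (N := MkFpMod (power_fp addC n (fpmodP J)))
  (nat_id (I A)) finj.
exact: addc_trans (pow_addc J n) (retract_addc hE).
Qed.

End Envelope.
End DualDuality.

(** * Resolutions by add(P) and coresolutions by add(J) *)

Section FlatProjective.
Variables (R : comPzRingType) (C : linCat R).
Hypotheses (addC : additive_category C) (wker : weak_kernels C)
  (fg : forall X Y : C, finitely_generated (hom X Y)).

Lemma flat_iff_dual_basis (A X : C) : flat_at A X <-> dual_basis A X.
Proof.
by split; [exact: (flat_dual_basis addC wker (fg A)) | exact: dual_basis_flat].
Qed.
End FlatProjective.

Theorem proposition8p9 (R : comPzRingType) (artR : artinian R)
    (E : lmodType R) (envE : injective_envelope_top E)
    (C : linCat R) (dualC : dualizing_variety C E) (A : C) :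
  (forall J : fpMod C, injective_envelope_top_of (yo A) J ->
     ((forall X : fpMod C, II J (Some 1%N) X <-> II J None X) <->
      (forall C' : C, projective_module (HomFrom (yo A) (yo C')))))
  /\
  (((forall X : fpMod C, PP (yo A) (Some 1%N) X <-> PP (yo A) None X) <->
    (forall C' : C, projective_module (Value (yo A) C'))) /\
   (forall C' : C, exists phi : {linear Value (yo A) C' -> HomTo (yo C') (yo A)},
      bijective phi)).
Proof.
have [[addC _ fg] dual] := dualC; pose addC' := additive_op addC.
pose D := dual_duality dual.
have [D' DD'] := reverse_duality D.
have kers := duality_fg_kernels D addC addC'.
have kers' := duality_fg_kernels D' addC' addC.
split; last split; last exact: yoneda_Value.
  move=> J [T [p [i [ps pker envJ]]]].
  have IP := duality_II_iff_PP (P := yofp addC' (A : opcat C)) addC addC' DD'.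
  rewrite IP; first last.
  - exact: (addc_envelope addC fg DD' artR ps pker envJ).
  - exact: (envelope_addc addC fg DD' ps pker envJ).
  rewrite (PP_iff_flat addC' kers' (A : opcat C)).
  have wker' := fg_kernels_weak_kernels_op addC kers.
  by split=> h X; have := h X;
    rewrite (flat_iff_dual_basis addC' wker' (fun Y Z => fg Z Y))
            -(projective_HomFrom (fg X A)).
rewrite (PP_iff_flat addC kers A).
have wker := fg_kernels_op_weak_kernels addC kers'.
by split=> h X; have := h X;
  rewrite (flat_iff_dual_basis addC wker fg) -(projective_Value (fg A X)).
Qed.
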